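(* Let $\mathcal{S}eq$ be the set of sequences $(t_n)_{n\ge 1}$ of elements of $H_{CK}$ such that (1) for all $n\ge 1$, $t_n$ is a nonzero linear combination of rooted trees with $n$ vertices; (2) $t_1=\bullet$; (3) the subalgebra generated by the $t_n$, $n\geq 1$, is a Hopf subalgebra of $H_{CK}$. Let $\Lambda$ be the set of double sequences $(\lambda_{i,j})_{i,j\geq 1}$ of elements of $\mathbb{K}$ such that: 1. (Pre-Lie relation) for any $i,j,k\geq 1$, $\lambda_{i,j}\lambda_{i+j,k}-\lambda_{j,k}\lambda_{i,j+k}=\lambda_{i,k}\lambda_{i+k,j}-\lambda_{k,j}\lambda_{i,j+k}$; 2. (Non-degeneracy) for any $n\geq 2$ there exist $i,j\geq 1$ with $i+j=n$ and $\lambda_{i,j}\neq 0$. Then the map sending $(t_n)_{n\ge 1}\in\mathcal{S}eq$ to the double sequence $(\lambda_{i,j})_{i,j\ge 1}$, where $\lambda_{i,j}$ is the coefficient of $t_j\otimes t_i$ in $\Delta(t_{i+j})$, is a bijection from $\mathcal{S}eq$ to $\Lambda$.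
   Context: $\mathbb{K}$ is a field of characteristic zero. $H_{CK}$ is the Connes-Kreimer Hopf algebra of rooted trees over $\mathbb{K}$: as an algebra it is the polynomial algebra on the set of nonempty (non-planar) rooted trees, monomials being identified with forests (product = disjoint union) and the unit $1$ with the empty forest. It is graded by the number of vertices. The coproduct is the algebra morphism given on a tree $t$ by $\Delta(t)=t\otimes 1+1\otimes t+\sum_c P^c(t)\otimes R^c(t)$, where $c$ runs over non-empty admissible cuts of $t$ (non-empty sets of edges containing at most one edge of any path from the root to a leaf), $R^c(t)$ is the component containing the root after removing the edges of $c$, and $P^c(t)$ is the forest of all the other components. The counit is the algebra morphism vanishing on all trees. $\bullet$ is the one-vertex tree. For $(t_n)\in\mathcal{S}eq$ the $t_n$ are algebraically independent, so the subalgebra $A$ they generate is $\mathbb{K}[t_1,t_2,\ldots]$, and ''the coefficient of $t_j\otimes t_i$'' is taken with respect to the basis of $A\otimes A$ formed by tensors of monomials in the $t_n$. *)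

(* Defs.v *)
From HB Require Import structures.
From mathcomp Require Import all_boot all_order all_algebra.
From mathcomp Require Import finmap monalg.
From mathcomp Require Import boolp classical_sets functions.

Set Implicit Arguments.
Unset Strict Implicit.
Unset Printing Implicit Defensive.

Import GRing.Theory.

Local Open Scope ring_scope.
Local Open Scope quotient_scope.
Local Open Scope classical_set_scope.

Inductive ptree : Type := PNode of seq ptree.

Fixpoint ptree_encode (t : ptree) : GenTree.tree unit :=
  let: PNode s := t in GenTree.Node 0 (map ptree_encode s).

Fixpoint ptree_decode (g : GenTree.tree unit) : ptree :=
  if g is GenTree.Node _ s then PNode (map ptree_decode s) else PNode [::].

Lemma ptree_encodeK : cancel ptree_encode ptree_decode.
Proof.
rewrite /cancel; fix IH 1 => -[s] /=; congr PNode.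
by elim: s => //= t s ->; rewrite IH.
Qed.

HB.instance Definition _ := Countable.copy ptree (can_type ptree_encodeK).

Definition ptree_le : rel ptree := relpre (@choice.pickle ptree) leq.

Fixpoint pnorm (t : ptree) : ptree :=
  let: PNode s := t in PNode (sort ptree_le (map pnorm s)).

Definition ptree_equiv : rel ptree := [rel t t' | pnorm t == pnorm t'].

Lemma ptree_equiv_refl : reflexive ptree_equiv.
Proof. by move=> t; rewrite /ptree_equiv /= eqxx. Qed.

Lemma ptree_equiv_sym : symmetric ptree_equiv.
Proof. by move=> t u; rewrite /ptree_equiv /= eq_sym. Qed.

Lemma ptree_equiv_trans : transitive ptree_equiv.
Proof. by move=> u t v /eqP tu /eqP uv; rewrite /ptree_equiv /= tu uv. Qed.

Canonical ptree_equivR :=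
  EquivRel ptree_equiv ptree_equiv_refl ptree_equiv_sym ptree_equiv_trans.

(** A (non-planar) rooted tree is a planar one up to permuting, at every
    vertex, the subtrees hanging from it; see [rtree_eqP]. *)
Definition rtree := {eq_quot ptree_equivR}.
HB.instance Definition _ := Choice.on rtree.

Definition rtree_of (t : ptree) : rtree := \pi_rtree t.

Lemma rtree_ofE t t' : (rtree_of t == rtree_of t') = (pnorm t == pnorm t').
Proof. by rewrite /rtree_of eqmodE. Qed.

Lemma rtree_eqP (s s' : seq ptree) :
  rtree_of (PNode s) = rtree_of (PNode s') <->
  perm_eq (map rtree_of s) (map rtree_of s').
Proof.
have le_total : total ptree_le by move=> t u; exact: leq_total.
have le_trans : transitive ptree_le by move=> t u v; exact: leq_trans.
have le_anti : antisymmetric ptree_le.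
  by move=> t u; rewrite /ptree_le /= -eqn_leq => /eqP /(pcan_inj (@choice.pickleK ptree)).
have repr_map r : map rtree_of (map repr (map rtree_of r)) = map rtree_of r.
  by rewrite -[RHS]map_id -map_comp; apply: eq_map => t /=; exact: reprK.
have norm_map r : map pnorm (map repr (map rtree_of r)) = map pnorm r.
  rewrite -!map_comp; apply: eq_map => t /=; apply/eqP.
  by rewrite -rtree_ofE /rtree_of reprK.
split=> [/eqP|ss'].
  rewrite rtree_ofE /= => /eqP[] /(perm_sortP le_total le_trans le_anti) nss'.
  pose f (u : ptree) : seq rtree :=
    [seq rtree_of v | v <- s ++ s' & pnorm v == u].
  pose g (u : ptree) : rtree := head (rtree_of u) (f u).
  have gP t : t \in s ++ s' -> g (pnorm t) = rtree_of t.
    move=> ts; rewrite /g /f.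
    have : t \in [seq v <- s ++ s' | pnorm v == pnorm t].
      by rewrite mem_filter eqxx.
    have : all (fun v => pnorm v == pnorm t)
             [seq v <- s ++ s' | pnorm v == pnorm t] by exact: filter_all.
    case: [seq v <- s ++ s' | _] => //= v r /andP[vt _] _.
    by apply/eqP; rewrite rtree_ofE.
  have gmap r : {subset r <= s ++ s'} -> map g (map pnorm r) = map rtree_of r.
    by move=> rss; rewrite -map_comp; apply/eq_in_map => t /rss /gP.
  rewrite -gmap; last by move=> t; rewrite mem_cat => ->.
  rewrite -(gmap s'); last by move=> t; rewrite mem_cat orbC => ->.
  exact: perm_map.
apply/eqP; rewrite rtree_ofE /=; apply/eqP; congr PNode.
apply/(perm_sortP le_total le_trans le_anti).
by rewrite -[map pnorm s]norm_map -[map pnorm s']norm_map; do 2 apply: perm_map.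
Qed.

Fixpoint psize (t : ptree) : nat := let: PNode s := t in (sumn (map psize s)).+1.

Definition rtree_size (T : rtree) : nat := psize (repr T).

Definition bullet : rtree := rtree_of (PNode [::]).

(** A set of edges of a planar tree, the tree itself included: each edge
    carries [true] if it belongs to the set and [false] otherwise. *)
Inductive etree : Type := ENode of seq (bool * etree).

(** All the sets of edges of [t], each listed once. *)
Fixpoint edge_sets (t : ptree) : seq etree :=
  let: PNode s := t in
  map ENode
    (foldr (fun u r => [seq e :: l | e <- [seq (b, c) | b <- [:: false; true],
                                                        c <- edge_sets u],
                                     l <- r])
       [:: [::]] s).

(** The paths from the root to the leaves, as sequences of marks of edges. *)
Fixpoint root_leaf_paths (c : etree) : seq bitseq :=
  let: ENode s := c in
  if s is [::] then [:: [::]]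
  else flatten [seq map (cons e.1) (root_leaf_paths e.2) | e <- s].

Definition nonempty_cut (c : etree) : bool := has (has id) (root_leaf_paths c).

Definition admissible (c : etree) : bool :=
  all (fun p => count id p <= 1)%N (root_leaf_paths c).

(** The connected component of the root once the marked edges are removed. *)
Fixpoint cut_root (c : etree) : ptree :=
  let: ENode s := c in
  PNode (flatten [seq (if e.1 then [::] else [:: cut_root e.2]) | e <- s]).

(** The other components: one below each marked edge. *)
Fixpoint cut_pruned (c : etree) : seq ptree :=
  let: ENode s := c in
  flatten [seq (if e.1 then [:: cut_root e.2] else [::]) ++ cut_pruned e.2
          | e <- s].

Section ProductMonomials.
Variables M N : conomType.

Definition pair_mone : M * N := (mone, mone).
Definition pair_mmul (u v : M * N) : M * N := (mmul u.1 v.1, mmul u.2 v.2).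

Lemma pair_mmulA : associative pair_mmul.
Proof. by move=> u v w; rewrite /pair_mmul /= !mulmA. Qed.

Lemma pair_mul1m : left_id pair_mone pair_mmul.
Proof. by case=> u v; rewrite /pair_mmul /= !mul1m. Qed.

Lemma pair_mulm1 : right_id pair_mone pair_mmul.
Proof. by case=> u v; rewrite /pair_mmul /= !mulm1. Qed.

Lemma pair_unitm u v :
  pair_mmul u v = pair_mone -> u = pair_mone /\ v = pair_mone.
Proof.
case: u v => [u1 u2] [v1 v2] [/unitm[-> ->] /unitm[-> ->]].
by split.
Qed.

Lemma pair_mmulC : commutative pair_mmul.
Proof. by move=> u v; rewrite /pair_mmul mulmC [mmul u.2 _]mulmC. Qed.

HB.instance Definition _ := Choice_isMonomialDef.Build (M * N)%type
  pair_mmulA pair_mul1m pair_mulm1 pair_unitm.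
HB.instance Definition _ :=
  MonomialDef_isConomialDef.Build (M * N)%type pair_mmulC.

End ProductMonomials.

Section Algebra.
Variable K : fieldType.

(** The tensor product of the monoid algebras of [M] and [N] is the monoid
    algebra of [M * N], the pair [(m, n)] being the tensor of [m] and [n]. *)
Definition tens (M N : conomType) (x : {malg K[M]}) (y : {malg K[N]}) :
    {malg K[(M * N)%type]} :=
  \sum_(m <- msupp x) \sum_(n <- msupp y) << x@_m * y@_n *g (m, n) >>.

(** The tensor product of [f] and [g] when they are linear. *)
Definition tens_map (M N M' N' : conomType)
    (f : {malg K[M]} -> {malg K[M']}) (g : {malg K[N]} -> {malg K[N']})
    (z : {malg K[(M * N)%type]}) : {malg K[(M' * N')%type]} :=
  \sum_(u <- msupp z) z@_u *: tens (f << u.1 >>) (g << u.2 >>).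

Definition tens_mul (M : conomType) (z : {malg K[(M * M)%type]}) : {malg K[M]} :=
  \sum_(u <- msupp z) << z@_u *g mmul u.1 u.2 >>.

(** The morphism of algebras from the polynomial algebra on [I] which sends
    each variable [i] to [f i]. *)
Definition alg_ext (I : choiceType) (B : comAlgType K) (f : I -> B)
    (x : {malg K[{cmonom I}]}) : B :=
  mmap (GRing.in_alg B)
       (fun m : {cmonom I} => \prod_(i <- finsupp m) f i ^+ m i) x.

Definition subalgebra (B : lalgType K) (A : set B) : Prop :=
  GRing.subalg_closed (mem A).

Definition gen_subalgebra (B : lalgType K) (G : set B) : set B :=
  smallest (@subalgebra B) G.

Definition lin_span (V : lmodType K) (G : set V) : set V :=
  smallest (fun A : set V => GRing.submod_closed (mem A)) G.

Definition forest : conomType := {cmonom rtree}.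

Definition HCK : comAlgType K := {malg K[forest]}.
Definition HCK2 : comAlgType K := {malg K[(forest * forest)%type]}.

Definition hforest (F : forest) : HCK := << F >>.
Definition htree (T : rtree) : HCK := hforest (ucm T).

Definition planar_forest (s : seq ptree) : HCK :=
  \prod_(t <- s) htree (rtree_of t).

(** The cuts are those of the planar representative [repr T]; the sum does not
    depend on the choice of this representative. *)
Definition comul_tree (T : rtree) : HCK2 :=
  tens (htree T) 1 + tens 1 (htree T)
  + \sum_(c <- edge_sets (repr T) | nonempty_cut c && admissible c)
      tens (planar_forest (cut_pruned c)) (htree (rtree_of (cut_root c))).

Definition comul (x : HCK) : HCK2 := alg_ext comul_tree x.

Definition counit (x : HCK) : K := alg_ext (B := K^o) (fun=> 0) x.

Definition is_antipode (S : {linear HCK -> HCK}) : Prop :=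
  forall x : HCK,
    tens_mul (tens_map S idfun (comul x)) = (counit x)%:A /\
    tens_mul (tens_map idfun S (comul x)) = (counit x)%:A.

(** An antipode is unique when it exists, so that the last condition says that
    [HCK] has an antipode and that it preserves [A]. *)
Definition hopf_subalgebra (A : set HCK) : Prop :=
  [/\ subalgebra A,
      comul @` A `<=` lin_span [set (tens a b : HCK2) | a in A & b in A]
    & exists2 S : {linear HCK -> HCK}, is_antipode S & S @` A `<=` A].

Definition posint : Type := {n : nat | (0 < n)%N}.
HB.instance Definition _ := Choice.on posint.

Definition posint1 : posint := exist _ 1%N (erefl true).

Lemma posint_add_subproof (i j : posint) : (0 < val i + val j)%N.
Proof. by rewrite addn_gt0 (valP i). Qed.

Definition posint_add (i j : posint) : posint :=
  exist _ (val i + val j)%N (posint_add_subproof i j).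

Local Infix "+p" := posint_add (at level 50, left associativity).

Definition Seq : set (posint -> HCK) :=
  [set t | [/\ forall n, t n != 0 /\
                 lin_span [set htree T | T in [set T | rtree_size T = val n]] (t n),
               t posint1 = htree bullet
             & hopf_subalgebra (gen_subalgebra (range t))]].

Definition Lambda : set (posint -> posint -> K) :=
  [set l | (forall i j k,
              l i j * l (i +p j) k - l j k * l i (j +p k)
              = l i k * l (i +p k) j - l k j * l i (j +p k)) /\
           (forall n : posint, (2 <= val n)%N ->
              exists i j, i +p j = n /\ l i j != 0)].

(** The tensors of polynomials in the [t n] which expand [x]: the variable [n]
    stands for [t n]. For [t] in [Seq] the [t n] are algebraically independent,
    hence there is at most one expansion. *)
Definition expansions (t : posint -> HCK) (x : HCK2) :
    set {malg K[({cmonom posint} * {cmonom posint})%type]} :=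
  [set y | tens_map (alg_ext t) (alg_ext t) y = x].

Definition structure_coef (t : posint -> HCK) (i j : posint) : K :=
  (xget 0 (expansions t (comul (t (i +p j)))))@_(ucm j, ucm i).

End Algebra.

(* Main.v *)
(** For a rooted tree [T], let [D_T = (T^* (x) id) Delta], where [T^*] is the
    linear form giving the coefficient of the forest [T].  As [T^*] vanishes on
    products, [D_T] is a derivation of [H_CK], and in characteristic zero an
    element killed by all the [D_T] is constant.

    If [t] is in [Seq], with coefficients [lambda], then
    [D_T (t_(i+j)) = a_T lambda_(i,j) t_i] for [T] of size [j], where [a_T] is
    the coefficient of [T] in [t_j].  By coassociativity [[D_T, D_U]] is the
    contraction of [Delta] with another form vanishing on products, and
    computing it on [t_n] in two ways yields the pre-Lie relation.  Since [t_n]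
    is a combination of trees, it is determined by the [D_T (t_n)] for [T] of
    size less than [n], hence by [lambda]: this gives the injectivity, and the
    non-degeneracy as [t_n] is not zero.

    Conversely, extend [lambda] in the pre-Lie relation by [lambda_(0,j) = 1],
    and build elements [c_j] of degree [j] and [q_(i,m)] of degree [m] such that
    [q_(i,0) = 1],
    [m q_(i,m) = \sum_(j=1..m) lambda_(i+m-j,j) c_j q_(i,m-j)] and
    [q_(0,m+1) = B+ (q_(1,m))], the last equation defining [c_(m+1)].  The
    pre-Lie relation implies that
    [D_T (q_(i,m)) = a_T lambda_(i+m-k,k) q_(i,m-k)] for [T] of size [k], and
    then that [Delta (q_(i,m)) = \sum_l q_(i+l,m-l) (x) q_(i,l)].  The sequence
    [t_n = q_(0,n)] is the preimage of [lambda]. *)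

From HB Require Import structures.
Require Import Defs.
From mathcomp Require Import all_boot all_algebra.
From mathcomp Require Import finmap monalg.
From mathcomp Require Import ring.
From mathcomp Require Import boolp classical_sets functions.
Set Implicit Arguments.
Unset Strict Implicit.
Unset Printing Implicit Defensive.
Import GRing.Theory.
Local Open Scope ring_scope.

(** * Linear extension of functions defined on monomials *)

(* [mon] and some definitions below are locked because the unification of two different
   elements [<< m >>] of a monoid algebra, or of two products of such elements,
   unfolds them and does not end. *)
HB.lock Definition mon (K : fieldType) (M : choiceType) (m : M) : {malg K[M]} :=
  << m >>.
Arguments mon {K M} m.

HB.lock Definition lext (K : fieldType) (M : choiceType) (V : lmodType K)
    (phi : M -> V) (x : {malg K[M]}) : V :=
  \sum_(m <- msupp x) x@_m *: phi m.

Section LinearExtension.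
Variables (K : fieldType) (M : choiceType).

Lemma mkmalgU_mon (m : M) : << m >> = mon m :> {malg K[M]}.
Proof. by rewrite unlock. Qed.

Lemma mcoeff_mon (m n : M) : (mon m : {malg K[M]})@_n = (m == n)%:R.
Proof. by rewrite -mkmalgU_mon mcoeffU. Qed.

Lemma mkmalgU_scale_mon (c : K) (m : M) : << c *g m >> = c *: (mon m : {malg K[M]}).
Proof. by apply/malgP => k; rewrite mcoeffZ mcoeff_mon mcoeffU mulr_natr. Qed.

Lemma malg_sumE (x : {malg K[M]}) : x = \sum_(m <- msupp x) x@_m *: mon m.
Proof. by rewrite {1}[x]monalgE; apply: eq_bigr => m _; rewrite mkmalgU_scale_mon. Qed.

Variable V : lmodType K.
Implicit Types (phi : M -> V) (x : {malg K[M]}).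

Lemma lextE phi x : lext phi x = \sum_(m <- msupp x) x@_m *: phi m.
Proof. by rewrite unlock. Qed.

Lemma lextEw phi x (d : {fset M}) : (msupp x `<=` d)%fset ->
  lext phi x = \sum_(m <- d) x@_m *: phi m.
Proof.
move=> le; rewrite lextE [LHS](big_fset_incl _ le) //= => m _ /mcoeff_outdom ->.
by rewrite scale0r.
Qed.

Lemma lext_is_linear phi : linear (lext phi).
Proof.
move=> c x y; set d := (msupp x `|` msupp y)%fset.
rewrite !(@lextEw _ _ d) ?fsubsetUl ?fsubsetUr //; last first.
  apply/fsubsetP => m; rewrite in_fsetU -!mcoeff_neq0 mcoeffD mcoeffZ.
  by apply: contraR; rewrite negb_or !negbK => /andP[/eqP-> /eqP->]; rewrite mulr0 addr0.
rewrite scaler_sumr -big_split /=; apply: eq_bigr => m _.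
by rewrite mcoeffD mcoeffZ scalerDl scalerA.
Qed.
HB.instance Definition _ phi :=
  GRing.isLinear.Build K {malg K[M]} V _ (lext phi) (lext_is_linear phi).

Lemma lext_mon phi m : lext phi (mon m) = phi m.
Proof. by rewrite !lextE -mkmalgU_mon msuppU oner_eq0 big_seq_fset1 mcoeffUU scale1r. Qed.

Lemma lext_unique (f : {malg K[M]} -> V) : linear f ->
  f =1 lext (fun m => f (mon m)).
Proof.
move=> lf x; pose F := GRing.isLinear.Build K {malg K[M]} V _ f lf.
pose f' : {linear {malg K[M]} -> V} := HB.pack f F.
have fE : f = f' by [].
by rewrite lextE {1}[x]malg_sumE fE linear_sum; apply: eq_bigr => m _; rewrite linearZ.
Qed.

Lemma malg_ext (f g : {malg K[M]} -> V) : linear f -> linear g ->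
  (forall m, f (mon m) = g (mon m)) -> f =1 g.
Proof.
move=> lf lg fg x; rewrite (lext_unique lf) (lext_unique lg).
by rewrite !lextE; apply: eq_bigr => m _; rewrite fg.
Qed.

Lemma eq_lext phi psi : phi =1 psi -> lext phi =1 lext psi.
Proof. by move=> e x; rewrite !lextE; apply: eq_bigr => m _; rewrite e. Qed.

End LinearExtension.

Section LinearExtensionTheory.
Variables (K : fieldType) (M : choiceType).

Lemma lext_id (x : {malg K[M]}) : lext (fun m => mon m) x = x.
Proof. by rewrite lextE [RHS]malg_sumE. Qed.

Lemma lextD (V : lmodType K) (phi psi : M -> V) (x : {malg K[M]}) :
  lext (fun m => phi m + psi m) x = lext phi x + lext psi x.
Proof. by rewrite !lextE -big_split; apply: eq_bigr => m _; rewrite scalerDr. Qed.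

Lemma lextB (V : lmodType K) (phi psi : M -> V) (x : {malg K[M]}) :
  lext (fun m => phi m - psi m) x = lext phi x - lext psi x.
Proof. by rewrite !lextE -sumrB; apply: eq_bigr => m _; rewrite scalerBr. Qed.

Lemma lextZ (V : lmodType K) c (phi : M -> V) (x : {malg K[M]}) :
  lext (fun m => c *: phi m) x = c *: lext phi x.
Proof.
by rewrite !lextE scaler_sumr; apply: eq_bigr => m _; rewrite !scalerA mulrC.
Qed.

Lemma linear_lext (V W : lmodType K) (f : {linear V -> W}) (phi : M -> V)
  (x : {malg K[M]}) : f (lext phi x) = lext (fun m => f (phi m)) x.
Proof. by rewrite !lextE linear_sum; apply: eq_bigr => m _; rewrite linearZ. Qed.

(** Reduces an identity between bilinear maps to pairs of monomials; most identities between tensors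
    below are checked this way. *)
Lemma malg_bilinear_ext (N : choiceType) (V : lmodType K)
  (f g : {malg K[M]} -> {malg K[N]} -> V) :
  (forall x, linear (f x)) -> (forall y, linear (f^~ y)) ->
  (forall x, linear (g x)) -> (forall y, linear (g^~ y)) ->
  (forall m n, f (mon m) (mon n) = g (mon m) (mon n)) -> forall x y, f x y = g x y.
Proof.
move=> f2 f1 g2 g1 fg x y; apply: (malg_ext (f1 y) (g1 y)) => m.
by apply: (malg_ext (f2 _) (g2 _)) => n; exact: fg.
Qed.

End LinearExtensionTheory.

Section Multiplicative.
Variables (K : fieldType) (M : conomType).

Lemma monM (m n : M) : mon m * mon n = mon (mmul m n) :> {malg K[M]}.
Proof. by rewrite -!mkmalgU_mon malgM_def fgmulUU mulr1. Qed.

Lemma monZM (a b : K) (m n : M) :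
  (a *: mon m) * (b *: mon n) = (a * b) *: mon (mmul m n) :> {malg K[M]}.
Proof. by rewrite -scalerAl -scalerAr monM scalerA. Qed.

Lemma mon1 : 1 = mon mone :> {malg K[M]}.
Proof. by rewrite -mkmalgU_mon. Qed.

Variables (B : algType K) (phi : M -> B).
Hypothesis phi1 : phi mone = 1.
Hypothesis phiM : {morph phi : m n / mmul m n >-> m * n}.

Lemma lext1 : lext phi 1 = 1.
Proof. by rewrite mon1 lext_mon. Qed.

Lemma lextM : {morph lext phi : x y / x * y}.
Proof.
move=> x y; apply: (@malg_bilinear_ext K M M B (fun x y => lext phi (x * y))
  (fun x y => lext phi x * lext phi y)) => //.
- by move=> {}x c y1 y2; rewrite mulrDr -scalerAr linearP.
- by move=> {}y c y1 y2 /=; rewrite mulrDl -scalerAl linearP.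
- by move=> {}x c y1 y2; rewrite linearP mulrDr -scalerAr.
- by move=> {}y c y1 y2 /=; rewrite linearP mulrDl -scalerAl.
by move=> m n; rewrite monM !lext_mon phiM.
Qed.

End Multiplicative.

(** * Multiplicative extension from the variables *)

HB.lock Definition cmap (K : fieldType) (I : choiceType) (B : comAlgType K)
    (f : I -> B) (m : {cmonom I}) : B :=
  \prod_(i <- finsupp m) f i ^+ m i.
Arguments cmap {K I B}.

Section Monomials.
Variable I : choiceType.
Implicit Types (i : I) (m : {cmonom I}).

(** Induction on the degree: a monomial other than the unit contains some variable, and dividing by
    it lowers the degree. *)
Lemma cmonom_ind (P : {cmonom I} -> Prop) :
  P mone -> (forall i m, P m -> P (mmul (ucm i) m)) -> forall m, P m.
Proof.
move=> P1 PM m; have [n] := ubnP (mdeg m); elim: n m => // n IHn m.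
have [->//|] := eqVneq m mone.
case: (fset_0Vmem (finsupp m)) => [m0|[i im]] m1.
  by case/negP: m1; apply/cmP => i; rewrite cm1; apply/eqP; rewrite cmE_eq0 m0.
have mE : m = mmul (ucm i) (divcm m (ucm i)).
  apply/eqP/cmP => j; rewrite cmM divcmE cmU; case: eqP => [<-|//].
    by rewrite subnKC // lt0n cmE_neq0.
  by rewrite subn0.
rewrite mE ltnS mdegM mdegU => lt; apply: PM; exact: IHn.
Qed.

Variables (K : fieldType) (B : comAlgType K) (f : I -> B).

Lemma cmapE m : cmap f m = \prod_(i <- finsupp m) f i ^+ m i.
Proof. by rewrite unlock. Qed.

Lemma cmapEw m (d : {fset I}) : (finsupp m `<=` d)%fset ->
  cmap f m = \prod_(i <- d) f i ^+ m i.
Proof.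
move=> le; rewrite cmapE (big_fset_incl _ le) // => i _.
by rewrite -cmE_eq0 => /eqP ->; rewrite expr0.
Qed.

Lemma cmap1 : cmap f mone = 1.
Proof. by rewrite cmapE mdom1 big_seq_fset0. Qed.

Lemma cmapU i : cmap f (ucm i) = f i.
Proof. by rewrite cmapE mdomU big_seq_fset1 cmUU expr1. Qed.

Lemma cmapM : {morph cmap f : m n / mmul m n >-> m * n}.
Proof.
move=> m n; rewrite (cmapEw (fsubsetUl (finsupp m) (finsupp n))).
rewrite (cmapEw (fsubsetUr (finsupp m) (finsupp n))) -big_split cmapE mdomD.
by apply: eq_bigr => i _; rewrite cmM exprD.
Qed.

Lemma alg_extE x : alg_ext f x = lext (cmap f) x.
Proof. by rewrite lextE; apply: eq_bigr => m _; rewrite mulr_algl cmapE. Qed.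

End Monomials.

(** * Tensor products of monoid algebras *)

Section Tensors.
Variables (K : fieldType) (M N : conomType).
Implicit Types (x : {malg K[M]}) (y : {malg K[N]}).

Lemma tensE x y : tens x y = lext (fun m => lext (fun n => mon (m, n)) y) x.
Proof.
rewrite lextE; apply: eq_bigr => m _; rewrite lextE scaler_sumr.
apply: eq_bigr => n _; by rewrite mkmalgU_scale_mon scalerA.
Qed.

Lemma tensEr x y : tens x y = lext (fun n => lext (fun m => mon (m, n)) x) y.
Proof.
rewrite /tens exchange_big lextE; apply: eq_bigr => m _; rewrite lextE scaler_sumr.
by apply: eq_bigr => n _; rewrite mkmalgU_scale_mon scalerA mulrC.
Qed.

Lemma tens_linearl y : linear (fun x => tens x y).
Proof. by move=> c x x'; rewrite !tensE linearP. Qed.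

Lemma tens_linearr x : linear (tens x : {malg K[N]} -> _).
Proof. by move=> c y y'; rewrite !tensEr linearP. Qed.

HB.instance Definition _ x :=
  GRing.isLinear.Build K {malg K[N]} {malg K[(M * N)%type]} _ (tens x) (tens_linearr x).

Lemma tensZl b x y : tens (b *: x) y = b *: tens x y.
Proof. by rewrite !tensE linearZ. Qed.

Lemma tens0l y : tens 0 y = 0 :> {malg K[(M * N)%type]}.
Proof. by rewrite tensE linear0. Qed.

Lemma tens_mon (m : M) (n : N) : tens (mon m) (mon n) = mon (m, n) :> {malg K[_]}.
Proof. by rewrite tensE !lext_mon. Qed.

End Tensors.

Section TensorAlgebra.
Variables (K : fieldType) (M N : conomType).

Lemma tensM (x x' : {malg K[M]}) (y y' : {malg K[N]}) :
  tens x y * tens x' y' = tens (x * x') (y * y').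
Proof.
apply: (@malg_bilinear_ext K M M _ (fun x x' => tens x y * tens x' y')
  (fun x x' => tens (x * x') (y * y'))).
- by move=> {}x c u v; rewrite tens_linearl mulrDr -scalerAr.
- by move=> {}x c u v /=; rewrite tens_linearl mulrDl -scalerAl.
- by move=> {}x c u v; rewrite mulrDr -scalerAr tens_linearl.
- by move=> {}x c u v /=; rewrite mulrDl -scalerAl tens_linearl.
move=> m m'; move: y y'.
apply: (@malg_bilinear_ext K N N _ (fun y y' => tens (mon m) y * tens (mon m') y')
  (fun y y' => tens (mon m * mon m') (y * y'))).
- by move=> {}y c u v; rewrite linearP mulrDr -scalerAr.
- by move=> {}y c u v /=; rewrite linearP mulrDl -scalerAl.
- by move=> {}y c u v; rewrite mulrDr -scalerAr linearP.
- by move=> {}y c u v /=; rewrite mulrDl -scalerAl linearP.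
by move=> n n'; rewrite !monM !tens_mon monM.
Qed.

Lemma tens11 : tens 1 1 = 1 :> {malg K[(M * N)%type]}.
Proof. by rewrite !mon1 tens_mon. Qed.

End TensorAlgebra.

(** * Rooted trees and forests *)

Lemma ptree_seq_ind (P : ptree -> Prop) :
  (forall s, (forall t, t \in s -> P t) -> P (PNode s)) -> forall t, P t.
Proof.
move=> IH; fix rec 1 => -[s]; apply: IH.
elim: s => [t|u s IHs t]; first by move=> h; apply: False_ind; exact: notF h.
by rewrite inE => /orP[/eqP->|]; [exact: rec | exact: IHs].
Qed.

Lemma psize_pnorm t : psize (pnorm t) = psize t.
Proof.
elim/ptree_seq_ind: t => s IH /=; congr _.+1.
rewrite !sumnE !big_map (perm_big (map pnorm s)) /=; last by rewrite perm_sort.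
by rewrite big_map big_seq [RHS]big_seq; apply: eq_bigr.
Qed.

Lemma rtree_of_repr T : rtree_of (repr T) = T.
Proof. exact: reprK. Qed.

Lemma rtree_size_of t : rtree_size (rtree_of t) = psize t.
Proof.
rewrite /rtree_size -psize_pnorm -[RHS]psize_pnorm; congr psize.
by apply/eqP; rewrite -rtree_ofE rtree_of_repr.
Qed.

Lemma rtree_size_gt0 T : (0 < rtree_size T)%N.
Proof. by rewrite /rtree_size; case: (repr T). Qed.

Definition forest_of (s : seq ptree) : {cmonom rtree} :=
  \big[mmul/mone]_(t <- s) ucm (rtree_of t).

Lemma forest_of_nil : forest_of [::] = mone.
Proof. exact: big_nil. Qed.

Lemma forest_of_cat s s' :
  forest_of (s ++ s') = mmul (forest_of s) (forest_of s').
Proof. by rewrite /forest_of big_cat. Qed.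

Lemma forest_of_cons t s :
  forest_of (t :: s) = mmul (ucm (rtree_of t)) (forest_of s).
Proof. by rewrite /forest_of big_cons. Qed.

Lemma forest_ofE s T : forest_of s T = count_mem T (map rtree_of s).
Proof.
elim: s => [|t s IH]; first by rewrite /forest_of big_nil cm1.
by rewrite forest_of_cons cmM cmU IH.
Qed.

(** Links equality of monomials with the permutation criterion of [rtree_eqP], so that grafting is
    well defined on forests. *)
Lemma forest_of_eqP s s' : forest_of s = forest_of s' <->
  perm_eq (map rtree_of s) (map rtree_of s').
Proof.
split=> [e|/permP e].
  by apply/allP => T _; rewrite /= -!forest_ofE e.
by apply/eqP/cmP => T; rewrite !forest_ofE e.
Qed.

(** A section of [forest_of], made of chosen planar representatives. *)
Definition trees (F : {cmonom rtree}) : seq ptree :=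
  flatten [seq nseq (F T) (repr T) | T <- finsupp F].

Lemma treesK F : forest_of (trees F) = F.
Proof.
apply/eqP/cmP => T; rewrite forest_ofE map_flatten -map_comp.
have -> : map (map rtree_of \o (fun T => nseq (F T) (repr T))) (finsupp F)
        = map (fun T => nseq (F T) T) (finsupp F).
  by apply: eq_map => U /=; rewrite map_nseq rtree_of_repr.
rewrite count_flatten -map_comp sumnE big_map.
under eq_bigr do rewrite /= count_nseq.
case: (mdomP F T) => h.
  rewrite (big_fsetD1 T) //= eqxx mul1n big1_fset ?addn0 // => U.
  by rewrite in_fsetD1 => /andP[/negbTE->].
rewrite big1_seq // => U /andP[_ hU] /=.
by case: (eqVneq U T) hU h => // -> ->.
Qed.

(** The operator B+ on forests: the trees become the children of a new root. *)
Definition graft (F : {cmonom rtree}) : rtree := rtree_of (PNode (trees F)).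

Lemma graft_forest_of s : graft (forest_of s) = rtree_of (PNode s).
Proof. by apply/rtree_eqP/forest_of_eqP; exact: treesK. Qed.

Lemma graft_inj : injective graft.
Proof. by move=> F G /rtree_eqP/forest_of_eqP; rewrite !treesK. Qed.

Lemma rtree_ind (P : rtree -> Prop) :
  (forall F : {cmonom rtree}, (forall T, F T != 0%N -> P T) -> P (graft F)) -> forall T, P T.
Proof.
move=> IH T; rewrite -[T]rtree_of_repr; elim/ptree_seq_ind: (repr T) => s IHs.
rewrite -graft_forest_of; apply: IH => U; rewrite forest_ofE -lt0n -has_count.
by rewrite has_map => /hasP[t ts /= /eqP<-]; exact: IHs.
Qed.

Lemma graft_surj T : exists F, T = graft F.
Proof. by elim/rtree_ind: T => F _; exists F. Qed.

Definition weight (F : {cmonom rtree}) : nat :=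
  \sum_(T <- finsupp F) F T * rtree_size T.

Lemma weightEw (F : {cmonom rtree}) (d : {fset rtree}) : (finsupp F `<=` d)%fset ->
  weight F = (\sum_(T <- d) F T * rtree_size T)%N.
Proof.
move=> le; rewrite /weight (big_fset_incl _ le) // => T _.
by rewrite -cmE_eq0 => /eqP->.
Qed.

Lemma weight1 : weight mone = 0%N.
Proof. by rewrite /weight mdom1 big_seq_fset0. Qed.

Lemma weightU T : weight (ucm T) = rtree_size T.
Proof. by rewrite /weight mdomU big_seq_fset1 cmUU mul1n. Qed.

Lemma weightM F G : weight (mmul F G) = (weight F + weight G)%N.
Proof.
rewrite (weightEw (fsubsetUl (finsupp F) (finsupp G))).
rewrite (weightEw (fsubsetUr (finsupp F) (finsupp G))) -big_split /weight mdomD.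
by apply: eq_bigr => T _; rewrite cmM mulnDl.
Qed.

Lemma weight_forest_of s : weight (forest_of s) = sumn (map psize s).
Proof.
elim: s => [|t s IH]; first by rewrite /forest_of big_nil weight1.
by rewrite forest_of_cons weightM weightU rtree_size_of IH.
Qed.

Lemma rtree_size_graft F : rtree_size (graft F) = (weight F).+1.
Proof. by rewrite rtree_size_of -{2}[F]treesK weight_forest_of. Qed.

Lemma weight_eq0 F : weight F = 0%N -> F = mone.
Proof.
elim/cmonom_ind: F => // T F _; rewrite weightM weightU => /eqP.
by rewrite addn_eq0 eqn0Ngt rtree_size_gt0.
Qed.

Lemma leq_size_weight (F : {cmonom rtree}) T : F T != 0%N -> (rtree_size T <= weight F)%N.
Proof.
rewrite cmE_neq0 => TF; rewrite /weight (big_fsetD1 T) //=.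
apply: leq_trans (leq_addr _ _); rewrite leq_pmull // lt0n cmE_neq0 //.
Qed.

Lemma bulletE : bullet = graft mone.
Proof. by rewrite -forest_of_nil graft_forest_of. Qed.

(** * The coproduct and grafting *)

Section Cuts.

(** There is a path below every vertex, so a marked edge always shows up in some path from the
    root. *)
Lemma root_leaf_paths_neq0 c : root_leaf_paths c != [::].
Proof.
move: c; fix rec 1 => -[[|[b c] s]] //=.
by case: (root_leaf_paths c) (rec c).
Qed.

Definition all_uncut : pred (seq (bool * etree)) :=
  all (fun e => ~~ e.1 && ~~ nonempty_cut e.2).

Lemma nonempty_cut_node l : nonempty_cut (ENode l) = ~~ all_uncut l.
Proof.
rewrite /nonempty_cut /= /all_uncut.
have -> : has (has id) (if l is [::] then [:: [::]]
     else flatten [seq map (cons e.1) (root_leaf_paths e.2) | e <- l])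
   = has (has id) (flatten [seq map (cons e.1) (root_leaf_paths e.2) | e <- l]).
  by case: l.
elim: l => //= -[b c] l IH; rewrite has_cat IH negb_and has_map /= -negb_or negbK.
congr (_ || _); rewrite /nonempty_cut; case: b => //=.
by rewrite (@eq_has _ _ predT) // has_predT lt0n size_eq0 root_leaf_paths_neq0.
Qed.

(** A marked edge forbids any mark below it; an unmarked one leaves the condition to the subtree. *)
Definition admissible_edge (e : bool * etree) : bool :=
  if e.1 then ~~ nonempty_cut e.2 else admissible e.2.

Lemma admissible_node l : admissible (ENode l) = all admissible_edge l.
Proof.
rewrite /admissible /=.
have -> : all (fun p => count id p <= 1)%N (if l is [::] then [:: [::]]
     else flatten [seq map (cons e.1) (root_leaf_paths e.2) | e <- l])
   = all (fun p => count id p <= 1)%N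
       (flatten [seq map (cons e.1) (root_leaf_paths e.2) | e <- l]).
  by case: l.
elim: l => //= -[b c] l IH; rewrite all_cat IH all_map; congr (_ && _).
rewrite /admissible_edge /=; case: b => //=.
rewrite /nonempty_cut -all_predC; apply: eq_all => p /=.
by rewrite has_count -leqNgt addSn add0n ltnS.
Qed.

(** Names the fold inside [edge_sets], for inductions on the list of children. *)
Definition edge_lists (s : seq ptree) : seq (seq (bool * etree)) :=
  foldr (fun u r => [seq e :: l | e <- [seq (b, c) | b <- [:: false; true],
                                                 c <- edge_sets u],
                                  l <- r]) [:: [::]] s.

Lemma edge_sets_node s : edge_sets (PNode s) = map ENode (edge_lists s).
Proof. by []. Qed.

Fixpoint uncut (t : ptree) : etree :=
  let: PNode s := t in ENode (map (fun u => (false, uncut u)) s).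

Lemma cut_root_uncut t : cut_root (uncut t) = t.
Proof.
elim/ptree_seq_ind: t => s IH /=; congr PNode; rewrite -map_comp.
elim: s IH => //= u s IHs IH; rewrite IH ?mem_head // IHs // => t ts.
by apply: IH; rewrite inE ts orbT.
Qed.

Lemma cut_pruned_uncut t : cut_pruned (uncut t) = [::].
Proof.
elim/ptree_seq_ind: t => s IH /=; rewrite -map_comp.
elim: s IH => //= u s IHs IH; rewrite IH ?mem_head // IHs // => t ts.
by apply: IH; rewrite inE ts orbT.
Qed.

Lemma filter_all_allpairs (T : Type) (q : pred T) (E : seq T) (r : seq (seq T)) :
  filter (all q) [seq e :: l | e <- E, l <- r]
  = [seq e :: l | e <- filter q E, l <- filter (all q) r].
Proof.
elim: E => //= e E IH; rewrite filter_cat IH filter_map.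
case qe: (q e) => /=; first by congr (map _ _ ++ _); apply: eq_filter => l /=; rewrite qe.
by rewrite (@eq_filter _ _ pred0) ?filter_pred0 // => l /=; rewrite qe.
Qed.

(** The empty cut is enumerated exactly once. This yields the term 1 (x) t, and a single term u (x)
    1 for a child u whose edge is cut. *)
Lemma filter_uncut t : filter (predC nonempty_cut) (edge_sets t) = [:: uncut t].
Proof.
elim/ptree_seq_ind: t => s IH; rewrite edge_sets_node filter_map.
rewrite (@eq_filter _ _ all_uncut); last first.
  by move=> l; rewrite /= nonempty_cut_node negbK.
have -> : filter all_uncut (edge_lists s) = [:: map (fun u => (false, uncut u)) s].
  elim: s IH => //= u s IHs IH; rewrite filter_all_allpairs IHs; last first.
    by move=> t ts; apply: IH; rewrite inE ts orbT.
  rewrite cats0 filter_cat !filter_map /= (@eq_filter _ _ (predC nonempty_cut)) //.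
  by rewrite IH ?mem_head // (@eq_filter _ _ pred0) // filter_pred0.
by [].
Qed.

(** Distributivity: the marks at and below the different children are chosen independently. *)
Lemma big_edge_lists (R : comNzRingType) (w : bool * etree -> R) s :
  \sum_(l <- edge_lists s) \prod_(e <- l) w e
  = \prod_(u <- s) (\sum_(c <- edge_sets u) w (false, c)
                    + \sum_(c <- edge_sets u) w (true, c)).
Proof.
elim: s => [|u s IH]; first by rewrite /= big_seq1 !big_nil.
rewrite big_cons -IH /= big_allpairs_dep /= cats0 big_cat !big_map /= mulrDl.
by congr (_ + _); rewrite mulr_suml; apply: eq_bigr => c _; rewrite mulr_sumr;
  apply: eq_bigr => l _; rewrite big_cons.
Qed.

End Cuts.

(** * Recursion for the coproduct of a tree *)

Section CoproductOfTrees.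
Variable K : fieldType.

Local Notation H := {malg K[{cmonom rtree}]}.
Local Notation H2 := {malg K[({cmonom rtree} * {cmonom rtree})%type]}.

Definition Bplus : H -> H := lext (fun F => mon (ucm (graft F))).
HB.instance Definition _ := GRing.Linear.on Bplus.

Definition id_Bplus : H2 -> H2 := lext (fun u => mon (u.1, ucm (graft u.2))).
HB.instance Definition _ := GRing.Linear.on id_Bplus.

Lemma Bplus_mon F : Bplus (mon F) = mon (ucm (graft F)).
Proof. exact: lext_mon. Qed.

Lemma id_Bplus_mon u : id_Bplus (mon u) = mon (u.1, ucm (graft u.2)).
Proof. exact: lext_mon. Qed.

Lemma id_Bplus_tens x y : id_Bplus (tens x y) = tens x (Bplus y).
Proof.
move: x y; apply: malg_bilinear_ext.
- by move=> x c u v; rewrite !linearP.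
- by move=> y c u v; rewrite tens_linearl linearP.
- by move=> x c u v; rewrite !linearP.
- by move=> y c u v; rewrite tens_linearl.
by move=> F G; rewrite tens_mon Bplus_mon id_Bplus_mon tens_mon.
Qed.

Lemma planar_forestE s : planar_forest K s = mon (forest_of s) :> H.
Proof.
elim: s => [|t s IH].
  by rewrite /planar_forest forest_of_nil big_nil; exact: mon1.
transitivity ((mon (ucm (rtree_of t)) : H) * mon (forest_of s)).
  by rewrite -IH -mkmalgU_mon; exact: big_cons.
by rewrite {IH} forest_of_cons monM.
Qed.

Lemma tens_forest_of s1 s2 s3 s4 :
  tens (mon (forest_of s1)) (mon (forest_of s2))
    * tens (mon (forest_of s3)) (mon (forest_of s4))
  = tens (mon (forest_of (s1 ++ s3))) (mon (forest_of (s2 ++ s4))) :> H2.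
Proof. by rewrite tensM !monM !forest_of_cat. Qed.

(* The empty cut is admissible and contributes [1 (x) t]. *)
Definition admissible_sum (t : ptree) : H2 :=
  \sum_(c <- edge_sets t | admissible c)
    tens (mon (forest_of (cut_pruned c))) (mon (ucm (rtree_of (cut_root c)))).

Lemma comul_tree_admissible T :
  comul_tree K T = tens (mon (ucm T)) 1 + admissible_sum (repr T) :> H2.
Proof.
have -> : comul_tree K T = (tens << ucm T >> 1 + tens 1 << ucm T >>
    + \sum_(c <- edge_sets (repr T) | nonempty_cut c && admissible c)
        tens (planar_forest K (cut_pruned c) : H)
             << ucm (rtree_of (cut_root c)) >>) :> H2.
  exact: erefl.
rewrite !mkmalgU_mon.
under [X in _ + X = _]eq_bigr do rewrite planar_forestE mkmalgU_mon.
rewrite /admissible_sum [X in _ = _ + X](bigID nonempty_cut) /= -addrA.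
under [X in _ + (_ + X) = _]eq_bigl do rewrite andbC.
rewrite [X in _ + X = _]addrC; do 2 apply: (f_equal2 _ erefl).
rewrite (eq_bigl (fun c => predC nonempty_cut c)) /=; last first.
  move=> c /=; apply: andb_idl; rewrite /nonempty_cut /admissible.
  rewrite -all_predC => /allP h; apply/allP => p /h /=.
  by rewrite has_count -leqNgt; case: count.
rewrite -big_filter filter_uncut big_seq1 cut_root_uncut cut_pruned_uncut.
by rewrite rtree_of_repr forest_of_nil -mon1.
Qed.

(** For each child u, either its edge is cut, with no cut below, which gives u (x) 1, or the edge is
    kept and the cut inside u is admissible. The root component grafts what remains of the
    children. *)
Lemma admissible_sum_rec s : admissible_sum (PNode s) =
  id_Bplus (\prod_(u <- s) (tens (mon (ucm (rtree_of u))) 1 + admissible_sum u)).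
Proof.
(* Contribution of one child: pruned trees in the left factor, the part still attached to the root
   in the right one. *)
pose w (e : bool * etree) : H2 :=
  tens (mon (forest_of ((if e.1 then [:: cut_root e.2] else [::]) ++ cut_pruned e.2)))
       (mon (forest_of (if e.1 then [::] else [:: cut_root e.2]))).
pose w' e := if admissible_edge e then w e else 0.
have -> : admissible_sum (PNode s)
    = id_Bplus (\sum_(l <- edge_lists s) \prod_(e <- l) w' e).
  rewrite /admissible_sum edge_sets_node big_map linear_sum big_mkcond /=.
  apply: eq_bigr => l _; rewrite admissible_node.
  have -> : \prod_(e <- l) w' e
      = if all admissible_edge l then \prod_(e <- l) w e else 0.
    elim: l => [|e l IH]; first by rewrite !big_nil.
    rewrite !big_cons IH /w' /=; case: ifP => _ /=; last by rewrite mul0r.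
    by case: ifP => // _; rewrite mulr0.
  case: ifP => _; last by rewrite linear0.
  have -> : \prod_(e <- l) w e =
    tens (mon (forest_of (cut_pruned (ENode l))))
     (mon (forest_of (flatten [seq (if e.1 then [::] else [:: cut_root e.2]) | e <- l]))).
    elim: l => [|e l IH].
      by rewrite /= big_nil forest_of_nil -mon1 tens11.
    by rewrite big_cons IH {IH} tens_forest_of.
  by rewrite id_Bplus_tens /= Bplus_mon graft_forest_of.
congr id_Bplus; rewrite big_edge_lists; apply: eq_bigr => u _.
rewrite addrC; congr (_ + _); last first.
  rewrite /admissible_sum [RHS]big_mkcond; apply: eq_bigr => c _.
  by rewrite /w' /admissible_edge /w /= forest_of_cons forest_of_nil mulm1.
transitivity (\sum_(c <- edge_sets u | predC nonempty_cut c) w (true, c)).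
  by rewrite [RHS]big_mkcond.
rewrite -big_filter filter_uncut big_seq1 /w /= cut_root_uncut cut_pruned_uncut.
by rewrite forest_of_cons forest_of_nil mulm1 -mon1.
Qed.

(** The recursion is a product over the children in a commutative algebra, so their order does not
    matter. *)
Lemma admissible_sum_equiv t t' :
  rtree_of t = rtree_of t' -> admissible_sum t = admissible_sum t'.
Proof.
elim/ptree_seq_ind: t t' => s IH [s'] /rtree_eqP pss'.
pose X' (T : rtree) : H2 := tens (mon (ucm T)) 1 + admissible_sum (repr T).
have sX u : u \in s -> tens (mon (ucm (rtree_of u))) 1 + admissible_sum u = X' (rtree_of u).
  by move=> us; rewrite /X' (IH u us (repr (rtree_of u))) // rtree_of_repr.
have s'X u : u \in s' -> tens (mon (ucm (rtree_of u))) 1 + admissible_sum u = X' (rtree_of u).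
  move=> us; have : rtree_of u \in map rtree_of s by rewrite (perm_mem pss') map_f.
  by case/mapP => v vs uv; rewrite uv -sX // (IH v vs u).
rewrite !admissible_sum_rec; congr id_Bplus.
rewrite (eq_big_seq _ sX) (eq_big_seq _ s'X).
by rewrite -(big_map rtree_of xpredT X') (perm_big _ pss') big_map.
Qed.

Definition Delta : H -> H2 := lext (cmap (comul_tree K : rtree -> H2)).
HB.instance Definition _ := GRing.Linear.on Delta.

Lemma comulE (x : HCK K) : comul x = Delta x.
Proof. exact: alg_extE. Qed.

Lemma Delta1 : Delta 1 = 1.
Proof. exact: (lext1 (cmap1 _)). Qed.

Lemma DeltaM : {morph Delta : x y / x * y}.
Proof. exact: (lextM (cmapM _)). Qed.

(** The cocycle identity Delta B+ = B+ (x) 1 + (id (x) B+) Delta. Together with multiplicativity it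
    determines the coproduct, and no later proof returns to cuts. *)
Lemma Delta_graft F :
  Delta (mon (ucm (graft F))) = tens (mon (ucm (graft F))) 1 + id_Bplus (Delta (mon F)).
Proof.
rewrite {1}/Delta lext_mon cmapU comul_tree_admissible; congr (_ + _).
rewrite (admissible_sum_equiv (rtree_of_repr _ : _ = rtree_of (PNode (trees F)))).
rewrite admissible_sum_rec; congr id_Bplus.
rewrite -{2}[F]treesK; elim: (trees F) => [|t s IH].
  by rewrite forest_of_nil big_nil -mon1 Delta1.
rewrite big_cons IH forest_of_cons -monM DeltaM; congr (_ * _).
rewrite /Delta lext_mon cmapU comul_tree_admissible; congr (_ + _).
by apply: admissible_sum_equiv; rewrite rtree_of_repr.
Qed.

Lemma Delta_Bplus x : Delta (Bplus x) = tens (Bplus x) 1 + id_Bplus (Delta x).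
Proof.
move: x; apply: malg_ext.
- by move=> c u v; rewrite !linearP.
- by move=> c u v; rewrite !linearP /= tens_linearl scalerDr addrACA.
by move=> F; rewrite Bplus_mon Delta_graft.
Qed.

End CoproductOfTrees.

(** * Counit and coassociativity *)

Lemma cmonom_ind_in (I : choiceType) (P : {cmonom I} -> Prop) (m : {cmonom I}) :
  P mone -> (forall m m', P m -> P m' -> P (mmul m m')) ->
  (forall i, m i != 0%N -> P (ucm i)) -> P m.
Proof.
move=> P1 PM; elim/cmonom_ind: m => // i m IH Pi; apply: PM.
  by apply: Pi; rewrite cmM cmUU.
by apply: IH => j mj; apply: Pi; rewrite cmM addn_eq0 negb_and mj orbT.
Qed.

(** Forests are generated from the empty one by products and B+, which fits multiplicativity and the
    cocycle identity. *)
Lemma forest_ind (P : {cmonom rtree} -> Prop) :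
  P mone -> (forall F G, P F -> P G -> P (mmul F G)) ->
  (forall F, P F -> P (ucm (graft F))) -> forall F, P F.
Proof.
move=> P1 PM PB F; apply: cmonom_ind_in => // T _.
elim/rtree_ind: T => G IH; apply: PB; exact: cmonom_ind_in.
Qed.

(* [f (x) id], and below [id (x) g]. *)
HB.lock Definition lslice (K : fieldType) (M N : conomType) (f : M -> K)
    (u : {malg K[(M * N)%type]}) : {malg K[N]} :=
  lext (fun u => f u.1 *: mon u.2) u.
Arguments lslice {K M N}.

HB.lock Definition rslice (K : fieldType) (M N : conomType) (g : N -> K)
    (u : {malg K[(M * N)%type]}) : {malg K[M]} :=
  lext (fun u => g u.2 *: mon u.1) u.
Arguments rslice {K M N}.

Section Slices.
Variables (K : fieldType) (M N : conomType).
Implicit Types (f : M -> K) (g : N -> K).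

Lemma lsliceE f (u : {malg K[(M * N)%type]}) : lslice f u = lext (fun u => f u.1 *: mon u.2) u.
Proof. by rewrite lslice.unlock. Qed.

Lemma rsliceE g (u : {malg K[(M * N)%type]}) : rslice g u = lext (fun u => g u.2 *: mon u.1) u.
Proof. by rewrite rslice.unlock. Qed.

Lemma lslice_is_linear f : linear (@lslice K M N f).
Proof. by move=> c u v; rewrite !lsliceE linearP. Qed.
HB.instance Definition _ f := GRing.isLinear.Build K {malg K[(M * N)%type]}
  {malg K[N]} _ (lslice f) (lslice_is_linear f).

Lemma rslice_is_linear g : linear (@rslice K M N g).
Proof. by move=> c u v; rewrite !rsliceE linearP. Qed.
HB.instance Definition _ g := GRing.isLinear.Build K {malg K[(M * N)%type]}
  {malg K[M]} _ (rslice g) (rslice_is_linear g).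

Lemma lslice_mon f (u : M * N) : lslice f (mon u) = f u.1 *: mon u.2.
Proof. by rewrite lsliceE lext_mon. Qed.

Lemma rslice_mon g (u : M * N) : rslice g (mon u) = g u.2 *: mon u.1.
Proof. by rewrite rsliceE lext_mon. Qed.

Lemma lslice_tens f (x : {malg K[M]}) (y : {malg K[N]}) :
  lslice f (tens x y) = lext (f : M -> K^o) x *: y.
Proof.
move: x y; apply: malg_bilinear_ext.
- by move=> x c u v; rewrite !linearP.
- by move=> y c u v; rewrite tens_linearl linearP.
- by move=> x c u v; rewrite scalerDr !scalerA mulrC.
- by move=> y c u v /=; rewrite linearP scalerDl scalerA.
by move=> m n; rewrite tens_mon lslice_mon lext_mon.
Qed.

Lemma rslice_tens g (x : {malg K[M]}) (y : {malg K[N]}) :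
  rslice g (tens x y) = lext (g : N -> K^o) y *: x.
Proof.
move: x y; apply: malg_bilinear_ext.
- by move=> x c u v; rewrite !linearP.
- by move=> y c u v; rewrite tens_linearl linearP.
- by move=> x c u v /=; rewrite linearP scalerDl scalerA.
- by move=> y c u v; rewrite scalerDr !scalerA mulrC.
by move=> m n; rewrite tens_mon rslice_mon lext_mon.
Qed.

End Slices.

HB.lock Definition eps (K : fieldType) (M : monomType) (m : M) : K :=
  (m == mone)%:R.
Arguments eps K {M} m.

Section Counit.
Variables (K : fieldType).
Local Notation eps := (eps K).

Lemma epsE (M : monomType) (m : M) : eps m = (m == mone)%:R.
Proof. by rewrite unlock. Qed.

Lemma eps1 (M : monomType) : eps (mone : M) = 1.
Proof. by rewrite epsE eqxx. Qed.

Lemma epsM (M : monomType) (m n : M) : eps (mmul m n) = eps m * eps n.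
Proof.
rewrite !epsE -natrM mulnb; congr (nat_of_bool _)%:R.
by apply/idP/idP => [/unitmP[-> ->]//|/andP[/eqP-> /eqP->]]; rewrite mulm1.
Qed.

Lemma eps_ucm (I : choiceType) (i : I) : eps (ucm i) = 0.
Proof. by rewrite epsE cm1_eq1. Qed.

Lemma lext_eps (M : monomType) (x : {malg K[M]}) :
  lext ((fun m => eps m) : M -> K^o) x = x@_mone.
Proof.
move: x; apply: (@malg_ext K M K^o).
- by move=> c u v; rewrite linearP.
- by move=> c u v; rewrite mcoeffD mcoeffZ.
by move=> m; rewrite lext_mon mcoeff_mon epsE.
Qed.

Lemma lsliceM (M N : conomType) (f g h : M -> K) (u v : {malg K[(M * N)%type]}) :
  (forall m n, h (mmul m n) = f m * g n) ->
  lslice h (u * v) = lslice f u * lslice g v.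
Proof.
move=> hfg; move: u v; apply: malg_bilinear_ext.
- by move=> x c u v; rewrite mulrDr -scalerAr linearP.
- by move=> y c u v; rewrite mulrDl -scalerAl linearP.
- by move=> x c u v; rewrite linearP mulrDr -scalerAr.
- by move=> y c u v; rewrite linearP mulrDl -scalerAl.
by case=> [a b] [c d]; rewrite monM !lslice_mon /= -scalerAl -scalerAr monM scalerA hfg.
Qed.

Lemma rsliceM (M N : conomType) (f g h : N -> K) (u v : {malg K[(M * N)%type]}) :
  (forall m n, h (mmul m n) = f m * g n) ->
  rslice h (u * v) = rslice f u * rslice g v.
Proof.
move=> hfg; move: u v; apply: malg_bilinear_ext.
- by move=> x c u v; rewrite mulrDr -scalerAr linearP.
- by move=> y c u v; rewrite mulrDl -scalerAl linearP.
- by move=> x c u v; rewrite linearP mulrDr -scalerAr.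
- by move=> y c u v; rewrite linearP mulrDl -scalerAl.
by case=> [a b] [c d]; rewrite monM !rslice_mon /= -scalerAl -scalerAr monM scalerA hfg.
Qed.

End Counit.

Section Hopf.
Variable K : fieldType.
Local Notation M := {cmonom rtree}.
Local Notation H := {malg K[M]}.
Local Notation H2 := {malg K[(M * M)%type]}.

Lemma Delta_mon1 : Delta (mon mone) = mon mone :> H2.
Proof. by rewrite -!mon1 Delta1. Qed.

Lemma lslice_id_Bplus (f : M -> K) u : lslice f (id_Bplus u) = Bplus (lslice f u).
Proof.
move: u; apply: malg_ext.
- by move=> c u v; rewrite !linearP.
- by move=> c u v; rewrite !linearP.
by move=> u; rewrite id_Bplus_mon !lslice_mon linearZ /= Bplus_mon.
Qed.

Lemma counit_l (x : H) : lslice (@eps K M) (Delta x) = x.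
Proof.
rewrite -[RHS]lext_id; move: x; apply: malg_ext.
- by move=> c u v; rewrite !linearP.
- by move=> c u v; rewrite !linearP.
move=> F; rewrite lext_mon; elim/forest_ind: F => [|F G IHF IHG|F IH].
- by rewrite Delta_mon1 lslice_mon /= eps1 scale1r.
- by rewrite -monM DeltaM (lsliceM _ _ (@epsM K M)) IHF IHG.
rewrite Delta_graft linearD /= lslice_id_Bplus IH Bplus_mon lslice_tens lext_mon.
by rewrite eps_ucm scale0r add0r.
Qed.

Lemma counit_r (x : H) : rslice (@eps K M) (Delta x) = x.
Proof.
rewrite -[RHS]lext_id; move: x; apply: malg_ext.
- by move=> c u v; rewrite !linearP.
- by move=> c u v; rewrite !linearP.
move=> F; rewrite lext_mon; elim/forest_ind: F => [|F G IHF IHG|F IH].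
- by rewrite Delta_mon1 rslice_mon /= eps1 scale1r.
- by rewrite -monM DeltaM (rsliceM _ _ (@epsM K M)) IHF IHG.
rewrite Delta_graft linearD /= rslice_tens lext_eps mon1 mcoeff_mon eqxx scale1r.
suff -> : rslice (@eps K M) (id_Bplus (Delta (mon F))) = 0 by rewrite addr0.
move: (Delta _); apply: malg_ext.
- by move=> c u v; rewrite !linearP.
- by move=> c u v; rewrite scaler0 addr0.
by move=> u; rewrite id_Bplus_mon rslice_mon /= eps_ucm scale0r.
Qed.

Local Notation H3 := {malg K[(M * (M * M))%type]}.

(** The tensor of [u] and [y] bracketed to the right, so that both sides of coassociativity have the
    same type. *)
Definition reassoc (u : H2) (y : H) : H3 :=
  lext (fun v => lext (fun n => mon (v.1, (v.2, n))) y) u.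

Lemma reassoc_mon u n : reassoc (mon u) (mon n) = mon (u.1, (u.2, n)).
Proof. by rewrite /reassoc !lext_mon. Qed.

Lemma reassoc_linearl y : linear (reassoc^~ y).
Proof. by move=> c u v; rewrite /reassoc linearP. Qed.

Lemma reassoc_linearr u : linear (reassoc u).
Proof.
move=> c y z; rewrite /reassoc -lextZ -lextD; apply: eq_lext => v.
by rewrite linearP.
Qed.
HB.instance Definition _ u := GRing.isLinear.Build K H H3 _ (reassoc u) (reassoc_linearr u).

Lemma reassocM u v m n :
  reassoc (u * v) (mon (mmul m n)) = reassoc u (mon m) * reassoc v (mon n).
Proof.
move: u v; apply: malg_bilinear_ext.
- by move=> x c u v; rewrite mulrDr -scalerAr reassoc_linearl.
- by move=> y c u v; rewrite mulrDl -scalerAl reassoc_linearl.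
- by move=> x c u v; rewrite reassoc_linearl mulrDr -scalerAr.
- by move=> y c u v; rewrite reassoc_linearl mulrDl -scalerAl.
by move=> u v; rewrite monM !reassoc_mon monM.
Qed.

Definition Delta_id : H2 -> H3 := lext (fun u => reassoc (Delta (mon u.1)) (mon u.2)).
HB.instance Definition _ := GRing.Linear.on Delta_id.

Definition id_Delta : H2 -> H3 := lext (fun u => tens (mon u.1) (Delta (mon u.2))).
HB.instance Definition _ := GRing.Linear.on id_Delta.

Lemma Delta_id_mon u : Delta_id (mon u) = reassoc (Delta (mon u.1)) (mon u.2).
Proof. exact: lext_mon. Qed.

Lemma id_Delta_mon u : id_Delta (mon u) = tens (mon u.1) (Delta (mon u.2)).
Proof. exact: lext_mon. Qed.

Lemma Delta_idM : {morph Delta_id : u v / u * v}.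
Proof.
by apply: lextM => u v /=; rewrite -reassocM -DeltaM monM.
Qed.

Lemma id_DeltaM : {morph id_Delta : u v / u * v}.
Proof.
by apply: lextM => u v /=; rewrite tensM monM -DeltaM monM.
Qed.

Definition id_id_Bplus : H3 -> H3 :=
  lext (fun u => mon (u.1, (u.2.1, ucm (graft u.2.2)))).
HB.instance Definition _ := GRing.Linear.on id_id_Bplus.

Lemma id_id_Bplus_mon u : id_id_Bplus (mon u) = mon (u.1, (u.2.1, ucm (graft u.2.2))).
Proof. exact: lext_mon. Qed.

Lemma Delta_id_id_Bplus u : Delta_id (id_Bplus u) = id_id_Bplus (Delta_id u).
Proof.
move: u; apply: malg_ext.
- by move=> c u v; rewrite !linearP.
- by move=> c u v; rewrite !linearP.
case=> F G; rewrite id_Bplus_mon !Delta_id_mon /=; move: (Delta (mon F)).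
apply: malg_ext.
- by move=> c u v; rewrite reassoc_linearl.
- by move=> c u v; rewrite reassoc_linearl linearP.
by move=> u; rewrite !reassoc_mon id_id_Bplus_mon.
Qed.

Lemma id_Delta_id_Bplus u : id_Delta (id_Bplus u) =
  reassoc (id_Bplus u) 1 + id_id_Bplus (id_Delta u).
Proof.
move: u; apply: malg_ext.
- by move=> c u v; rewrite !linearP.
- by move=> c u v; rewrite !linearP /= reassoc_linearl scalerDr addrACA.
case=> F G; rewrite id_Bplus_mon !id_Delta_mon /= Delta_graft linearD /=.
congr (_ + _); first by rewrite mon1 !tens_mon reassoc_mon.
move: (Delta (mon G)); apply: malg_ext.
- by move=> c u v; rewrite !linearP.
- by move=> c u v; rewrite !linearP.
by move=> u; rewrite id_Bplus_mon !tens_mon id_id_Bplus_mon.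
Qed.

(** Both sides are multiplicative, and on B+ of a forest the cocycle identity reduces the claim to
    that forest. *)
Lemma coassoc (x : H) : Delta_id (Delta x) = id_Delta (Delta x).
Proof.
move: x; apply: malg_ext.
- by move=> c u v; rewrite !linearP.
- by move=> c u v; rewrite !linearP.
elim/forest_ind => [|F G IHF IHG|F IH].
- rewrite Delta_mon1 Delta_id_mon id_Delta_mon /= !Delta_mon1.
  by rewrite reassoc_mon tens_mon.
- by rewrite -monM DeltaM Delta_idM id_DeltaM IHF IHG.
rewrite Delta_graft [LHS]linearD [RHS]linearD /=.
rewrite Delta_id_id_Bplus id_Delta_id_Bplus IH addrA; congr (_ + _).
have E : tens (mon (ucm (graft F))) 1 = mon (ucm (graft F), mone) :> H2.
  by rewrite mon1 tens_mon.
rewrite E Delta_id_mon id_Delta_mon /= Delta_graft E Delta_mon1 tens_mon -mon1.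
have := reassoc_linearl 1 1 (mon (ucm (graft F), mone)) (id_Bplus (Delta (mon F))).
by rewrite !scale1r /= => ->; congr (_ + _); rewrite mon1 reassoc_mon.
Qed.

End Hopf.

(** * The derivations attached to the trees *)

Section Support.
Variables (K : fieldType) (M : choiceType).
Implicit Types (P Q : M -> Prop) (x y : {malg K[M]}).

(** Membership in the span of the monomials satisfying [P]; homogeneity and being a combination of
    trees are instances. *)
Definition supp_in P x : Prop := forall m, x@_m != 0 -> P m.

Lemma supp_in_sub P Q x : (forall m, P m -> Q m) -> supp_in P x -> supp_in Q x.
Proof. by move=> PQ Px m /Px /PQ. Qed.

Lemma supp_in0 P : supp_in P 0.
Proof. by move=> m; rewrite mcoeff0 eqxx. Qed.

Lemma supp_inD P x y : supp_in P x -> supp_in P y -> supp_in P (x + y).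
Proof.
move=> Px Py m; rewrite mcoeffD; have [x0|/Px//] := eqVneq (x@_m) 0.
by rewrite x0 add0r => /Py.
Qed.

Lemma supp_inZ P c x : supp_in P x -> supp_in P (c *: x).
Proof. by move=> Px m; rewrite mcoeffZ mulf_eq0 negb_or => /andP[_ /Px]. Qed.

Lemma supp_in_sum P (J : Type) (r : seq J) (A : pred J) (F : J -> {malg K[M]}) :
  (forall j, A j -> supp_in P (F j)) -> supp_in P (\sum_(j <- r | A j) F j).
Proof.
move=> PF; elim/big_ind: _ => [|x y|//]; [exact: supp_in0 | exact: supp_inD].
Qed.

Lemma supp_in_mon P m : P m -> supp_in P (mon m).
Proof.
by move=> Pm n; rewrite mcoeff_mon; have [<-//|_] := eqVneq m n; rewrite eqxx.
Qed.

Lemma supp_in_eq0 x : supp_in (fun=> False) x -> x = 0.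
Proof.
by move=> h; apply/malgP => m; rewrite mcoeff0; apply/eqP; apply: contraT => /h.
Qed.

Lemma supp_in1 m x : supp_in (eq^~ m) x -> x = x@_m *: mon m.
Proof.
move=> h; apply/malgP => n; rewrite mcoeffZ mcoeff_mon.
have [->|mn] := eqVneq m n; first by rewrite mulr1.
by rewrite mulr0; apply/eqP; apply: contraT => /h nm; rewrite nm eqxx in mn.
Qed.

End Support.

Lemma supp_in_lext (K : fieldType) (M N : choiceType) (P : M -> Prop)
  (Q : N -> Prop) (phi : M -> {malg K[N]}) x :
  supp_in P x -> (forall m, P m -> supp_in Q (phi m)) -> supp_in Q (lext phi x).
Proof.
move=> Px Pphi; rewrite lextE big_seq; apply: supp_in_sum => m mx.
by apply: supp_inZ; apply: Pphi; apply: Px; rewrite mcoeff_neq0.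
Qed.

Lemma supp_inM (K : fieldType) (M : monomType) (P Q R : M -> Prop) (x y : {malg K[M]}) :
  supp_in P x -> supp_in Q y -> (forall m n, P m -> Q n -> R (mmul m n)) ->
  supp_in R (x * y).
Proof.
move=> Px Qy h m; rewrite mcoeff_neq0 => /msuppM_le[k1 [k2 [kx ky ->]]].
by apply: h; [apply: Px | apply: Qy]; rewrite mcoeff_neq0.
Qed.

HB.lock Definition ucm_dual (K : fieldType) (I : choiceType) (i : I) (m : {cmonom I}) : K :=
  (m == ucm i)%:R.
Arguments ucm_dual K {I} i m.

Section Infinitesimal.
Variable K : fieldType.

(* For [f] extended linearly, this says that [f] vanishes on [1] and on the
   products of elements of the augmentation ideal. *)
Definition infinitesimal (M : conomType) (f : M -> K) : Prop :=
  forall m n, f (mmul m n) = f m * eps K n + eps K m * f n.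

Lemma infinitesimal1 (M : conomType) (f : M -> K) : infinitesimal f -> f mone = 0.
Proof.
move=> /(_ mone mone); rewrite mulm1 !eps1 mulr1 mul1r => /eqP.
by rewrite -subr_eq subrr => /eqP <-.
Qed.

Lemma infinitesimalM (M : conomType) (f : M -> K) (x y : {malg K[M]}) : infinitesimal f ->
  lext (f : M -> K^o) (x * y) =
  lext (f : M -> K^o) x * y@_mone + x@_mone * lext (f : M -> K^o) y.
Proof.
move=> inf_f; move: x y; apply: (@malg_bilinear_ext K M M K^o).
- by move=> x c u v; rewrite mulrDr -scalerAr linearP.
- by move=> y c u v; rewrite mulrDl -scalerAl linearP.
- move=> x c u v; rewrite (linearP (lext (f : M -> K^o))) /= mcoeffD mcoeffZ.
  rewrite /GRing.scale /=; ring.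
- move=> y c u v; rewrite (linearP (lext (f : M -> K^o))) /= mcoeffD mcoeffZ.
  rewrite /GRing.scale /=; ring.
by move=> m n; rewrite monM !lext_mon !mcoeff_mon inf_f !epsE.
Qed.

(** Infinitesimal functions vanish on the unit and on products of two non-units, so only variables
    matter. *)
Lemma infinitesimal_unique (I : choiceType) (f g : {cmonom I} -> K) :
  infinitesimal f -> infinitesimal g -> (forall i, f (ucm i) = g (ucm i)) -> f =1 g.
Proof.
move=> inf_f inf_g fg; elim/cmonom_ind => [|i m IH]; first by rewrite !infinitesimal1.
by rewrite inf_f inf_g fg IH.
Qed.

Lemma ucm_dualE (I : choiceType) (i : I) (m : {cmonom I}) :
  ucm_dual K i m = (m == ucm i)%:R.
Proof. by rewrite unlock. Qed.

Lemma ucm_dual_infinitesimal (I : choiceType) (i : I) : infinitesimal (ucm_dual K i).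
Proof.
move=> F G; rewrite !ucm_dualE !epsE.
have u1 : (mone == ucm i :> {cmonom I}) = false by rewrite eq_sym cm1_eq1.
have [->|F1] := eqVneq F mone; first by rewrite mul1m u1 mul0r add0r mul1r.
have [->|G1] := eqVneq G mone; first by rewrite mulm1 mulr1 mul0r addr0.
rewrite mulr0 mul0r addr0; case: eqP => // /(congr1 mdeg).
move: F1 G1; rewrite -!mdeg_eq0 mdegM mdegU.
by case: (mdeg F) => // a; case: (mdeg G) => // b _ _; rewrite addSn addnS.
Qed.

Lemma lext_ucm_dual (I : choiceType) (i : I) (x : {malg K[{cmonom I}]}) :
  lext (ucm_dual K i : _ -> K^o) x = x@_(ucm i).
Proof.
move: x; apply: (@malg_ext K _ K^o).
- by move=> c u v; rewrite linearP.
- by move=> c u v; rewrite mcoeffD mcoeffZ.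
by move=> F; rewrite lext_mon mcoeff_mon ucm_dualE.
Qed.

End Infinitesimal.

HB.lock Definition D (K : fieldType) (f : {cmonom rtree} -> K)
    (x : {malg K[{cmonom rtree}]}) : {malg K[{cmonom rtree}]} :=
  lslice f (Delta x).
Arguments D {K}.

HB.lock Definition D_id (K : fieldType) (f : {cmonom rtree} -> K)
    (u : {malg K[({cmonom rtree} * {cmonom rtree})%type]}) :
    {malg K[({cmonom rtree} * {cmonom rtree})%type]} :=
  lext (fun u => tens (D f (mon u.1)) (mon u.2)) u.
Arguments D_id {K}.

Section Derivations.
Variable K : fieldType.
Local Notation M := {cmonom rtree}.
Local Notation H := {malg K[M]}.
Local Notation H2 := {malg K[(M * M)%type]}.
Implicit Types (f g : M -> K) (x y : H) (T : rtree).

Lemma DE f x : D f x = lslice f (Delta x).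
Proof. by rewrite unlock. Qed.

Lemma D_is_linear f : linear (D f).
Proof. by move=> c x y; rewrite !DE (linearP (@Delta K)) linearP. Qed.
HB.instance Definition _ f := GRing.isLinear.Build K H H _ (D f) (D_is_linear f).

Lemma D_id_is_linear f : linear (D_id f).
Proof. by move=> c u v; rewrite D_id.unlock linearP. Qed.
HB.instance Definition _ f := GRing.isLinear.Build K H2 H2 _ (D_id f) (D_id_is_linear f).

Lemma D_id_mon f u : D_id f (mon u) = tens (D f (mon u.1)) (mon u.2).
Proof. by rewrite D_id.unlock lext_mon. Qed.

Lemma D_id_tens f x y : D_id f (tens x y) = tens (D f x) y.
Proof.
move: x y; apply: malg_bilinear_ext.
- by move=> x c u v; rewrite linearP /= linearP.
- by move=> y c u v; rewrite tens_linearl linearP.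
- by move=> x c u v; rewrite linearP.
- by move=> y c u v; rewrite linearP tens_linearl.
by move=> m n; rewrite tens_mon D_id_mon.
Qed.

Lemma lslice_reassoc f u n : lslice f (reassoc u (mon n)) = tens (lslice f u) (mon n).
Proof.
move: u; apply: malg_ext.
- by move=> c u v; rewrite reassoc_linearl linearP.
- by move=> c u v; rewrite linearP tens_linearl.
by move=> u; rewrite reassoc_mon !lslice_mon -tens_mon tensZl.
Qed.

Lemma D_idE f u : D_id f u = lslice f (Delta_id u).
Proof.
move: u; apply: malg_ext.
- by move=> c u v; rewrite linearP.
- by move=> c u v; rewrite linearP /= linearP.
by move=> u; rewrite D_id_mon Delta_id_mon lslice_reassoc DE.
Qed.

Lemma Delta_lslice f u : Delta (lslice f u) = lslice f (id_Delta u).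
Proof.
move: u; apply: malg_ext.
- by move=> c u v; rewrite linearP /= linearP.
- by move=> c u v; rewrite linearP /= linearP.
by move=> u; rewrite lslice_mon linearZ /= id_Delta_mon lslice_tens lext_mon.
Qed.

(** By coassociativity, contracting the first factor of the iterated coproduct lets [D f] act on the
    left factor of Delta. *)
Lemma Delta_D f x : Delta (D f x) = D_id f (Delta x).
Proof. by rewrite DE Delta_lslice -coassoc D_idE. Qed.

(** The form on the right is the convolution product of [f] and [g]. *)
Lemma D_D f g x : D g (D f x) = D (fun F => lext (g : M -> K^o) (D f (mon F)) : K) x.
Proof.
rewrite [LHS]DE Delta_D [RHS]DE; move: (Delta x); apply: malg_ext.
- by move=> c u v; rewrite linearP /= linearP.
- by move=> c u v; rewrite linearP.
by move=> u; rewrite D_id_mon lslice_tens lslice_mon.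
Qed.

Lemma counit_D f x : (D f x)@_mone = lext (f : M -> K^o) x.
Proof.
rewrite -[in RHS](counit_r x) DE; move: (Delta x); apply: (@malg_ext K _ K^o).
- by move=> c u v; rewrite linearP /= mcoeffD mcoeffZ.
- by move=> c u v; rewrite linearP /= linearP.
move=> u; rewrite lslice_mon rslice_mon mcoeffZ linearZ /= lext_mon mcoeff_mon.
by rewrite epsE mulrC.
Qed.

Lemma D_derivation f x y : infinitesimal f ->
  D f (x * y) = D f x * y + x * D f y.
Proof.
(* Once the factors [x] and [y] are written as counit slices, both sides are bilinear in the two
   coproducts and monomials suffice. *)
move=> inf_f; rewrite !DE DeltaM -[X in _ * X + _](counit_l y) -[X in _ + X * _](counit_l x).
have linMl (F : H2 -> H) b : linear F -> linear (fun v => F v * b).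
  by move=> lF c v w; rewrite lF mulrDl -scalerAl.
have linMr (F : H2 -> H) b : linear F -> linear (fun v => b * F v).
  by move=> lF c v w; rewrite lF mulrDr -scalerAr.
have linD (F G : H2 -> H) : linear F -> linear G -> linear (fun v => F v + G v).
  by move=> lF lG c v w; rewrite lF lG scalerDr addrACA.
move: (Delta x) (Delta y); apply: malg_bilinear_ext.
- by move=> u c v w; rewrite mulrDr -scalerAr linearP.
- by move=> u c v w; rewrite mulrDl -scalerAl linearP.
- by move=> u; apply: linD; apply: linMr; exact: linearP.
- by move=> u; apply: linD; apply: linMl; exact: linearP.
move=> u v; rewrite monM !lslice_mon /= inf_f scalerDl.
by rewrite [X in _ = X + _]monZM [X in _ = _ + X]monZM.
Qed.

Definition homogeneous n : H -> Prop := supp_in (fun F => weight F = n).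

Lemma homogeneousM m n x y : homogeneous m x -> homogeneous n y ->
  homogeneous (m + n) (x * y).
Proof. by move=> hx hy; apply: (supp_inM hx hy) => F G; rewrite weightM => -> ->. Qed.

Lemma homogeneous1 : homogeneous 0 1.
Proof. by rewrite mon1; apply: supp_in_mon; rewrite weight1. Qed.

Lemma Delta_homogeneous F :
  supp_in (fun u => weight u.1 + weight u.2 = weight F)%N (Delta (mon F : H)).
Proof.
elim/forest_ind: F => [|F G IHF IHG|F IH].
- by rewrite Delta_mon1; apply: supp_in_mon; rewrite /= weight1.
- rewrite -monM DeltaM; apply: (supp_inM IHF IHG) => -[a b] [c d] /= e e'.
  by rewrite !weightM -e -e' addnACA.
rewrite Delta_graft; apply: supp_inD.
  by rewrite mon1 tens_mon; apply: supp_in_mon; rewrite /= weight1 addn0.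
apply: (supp_in_lext IH) => -[a b] /= e; apply: supp_in_mon => /=.
by rewrite !weightU !rtree_size_graft -e addnS.
Qed.

Lemma D_ucm_dual_homogeneous T n x : homogeneous n x ->
  supp_in (fun F => weight F + rtree_size T = n)%N (D (ucm_dual K T) x).
Proof.
move=> hx; rewrite (lext_unique (D_is_linear _)); apply: (supp_in_lext hx) => F <-.
rewrite DE lsliceE; apply: (supp_in_lext (@Delta_homogeneous F)) => -[a b] /= <-.
rewrite ucm_dualE; case: eqP => [->|_]; last by rewrite scale0r; exact: supp_in0.
by rewrite scale1r; apply: supp_in_mon; rewrite weightU addnC.
Qed.

Definition is_tree (F : M) : Prop := exists T, F = ucm T.

(** By the cocycle identity, the coproduct of a tree t is t (x) 1 plus terms whose right factor is a
    tree. *)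
Lemma D_is_tree f x : supp_in is_tree x ->
  supp_in (fun F => F = mone \/ is_tree F) (D f x).
Proof.
move=> hx; rewrite (lext_unique (D_is_linear _)); apply: (supp_in_lext hx) => _ [T ->].
rewrite DE; have [F ->] := graft_surj T; rewrite Delta_graft linearD /=; apply: supp_inD.
  by rewrite lslice_tens mon1; apply: supp_inZ; apply: supp_in_mon; left.
rewrite lslice_id_Bplus; apply: (@supp_in_lext _ _ _ (fun=> True)) => // G _.
by apply: supp_in_mon; right; exists (graft G).
Qed.

Lemma D_ucm_dual_large T n x : homogeneous n x -> (n <= rtree_size T)%N ->
  D (ucm_dual K T) x = x@_(ucm T) *: 1.
Proof.
move=> hx nT; rewrite -lext_ucm_dual -counit_D mon1; apply: supp_in1.
apply: supp_in_sub (D_ucm_dual_homogeneous (T := T) hx) => F e.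
by apply: weight_eq0; apply/eqP; rewrite -leqn0 -(leq_add2r (rtree_size T)) e.
Qed.

(* When [T] is of maximal size among the trees of [F], [D_T] acts on [F] as the
   partial derivative with respect to [T]. *)
Lemma euler T (F : M) : (forall U, F U != 0%N -> rtree_size U <= rtree_size T)%N ->
  mon (ucm T) * D (ucm_dual K T) (mon F) = (F T)%:R *: (mon F : H).
Proof.
elim/cmonom_ind: F => [|U F IH] hF.
  rewrite -mon1 (D_ucm_dual_large homogeneous1 (leq0n _)).
  by rewrite mon1 mcoeff_mon eq_sym cm1_eq1 cm1 !scale0r mulr0.
rewrite -monM D_derivation; last exact: ucm_dual_infinitesimal.
rewrite mulrDr [X in _ + X]mulrCA [X in _ + _ * X]IH; last first.
  by move=> V FV; apply: hF; rewrite cmM addn_eq0 negb_and FV orbT.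
rewrite -[X in _ + X]scalerAr cmM natrD scalerDl; apply: (f_equal2 _ _ erefl).
have hU : homogeneous (rtree_size U) (mon (ucm U)).
  by apply: supp_in_mon; rewrite weightU.
rewrite (D_ucm_dual_large hU); last by apply: hF; rewrite cmM cmUU.
rewrite mcoeff_mon cmU; have [->|UT] := eqVneq U T.
  by rewrite eqxx !scale1r mul1r.
case: eqP => [/(congr1 (fun m : M => m T))|_].
  by rewrite !cmU eqxx (negbTE UT).
by rewrite !scale0r mul0r mulr0.
Qed.

End Derivations.

(** * Joint kernel of the derivations *)

Section Kernel.
Variable K : fieldType.
Hypothesis K0 : [pchar K] =i pred0.
Local Notation M := {cmonom rtree}.
Local Notation H := {malg K[M]}.
Local Notation H2 := {malg K[(M * M)%type]}.

(** If n+1 bounds the sizes of the trees occurring in [w], then [euler] for a tree of that size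
    multiplies each coefficient by a multiplicity, so characteristic zero excludes this tree.
    Descending on the bound leaves only the empty forest. *)
Lemma D_kernel (w : H) : (forall T, D (ucm_dual K T) w = 0) -> w = w@_mone *: 1.
Proof.
move=> w0.
pose bounded n := forall (F : M) T,
  w@_F != 0 -> F T != 0%N -> (rtree_size T <= n)%N.
have step n : bounded n.+1 -> bounded n.
  move=> hn F T wF FT; rewrite leqNgt; apply/negP => nT.
  have Tn : rtree_size T = n.+1 by apply/eqP; rewrite eqn_leq (hn F).
  have : mon (ucm T) * D (ucm_dual K T) w = 0 by rewrite w0 mulr0.
  rewrite -[w]lext_id linear_lext lextE mulr_sumr big_seq.
  under eq_bigr => G Gw.
    rewrite -scalerAr euler; last by move=> U; rewrite Tn; apply: hn; rewrite mcoeff_neq0.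
    over.
  rewrite -big_seq => /(congr1 (mcoeff F)); rewrite mcoeff0 raddf_sum /=.
  rewrite (big_fsetD1 F) -?mcoeff_neq0 //= big1_fset ?addr0.
    rewrite !mcoeffZ mcoeff_mon eqxx mulr1 => /eqP.
    by rewrite mulf_eq0 (negbTE wF) ((pcharf0P K).1 K0) (negbTE FT).
  move=> G; rewrite in_fsetD1 => /andP[/negbTE GF _] _.
  by rewrite !mcoeffZ mcoeff_mon GF !mulr0.
have h n : bounded n -> bounded 0%N by elim: n => // n IH /step /IH.
rewrite mon1; apply: supp_in1 => F wF; apply/eqP/cmP => T; rewrite cm1; apply/eqP.
apply: contraT => FT.
suff : (rtree_size T <= 0)%N by rewrite leqNgt rtree_size_gt0.
apply: (h (\max_(G <- msupp w) weight G)) FT => // {}F {}T {}wF FT.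
apply: leq_trans (leq_size_weight FT) _.
by apply: leq_bigmax_seq => //; rewrite -mcoeff_neq0.
Qed.

(** Taking a coordinate along the second factor commutes with D_T on the first, so [D_kernel] makes
    every such slice constant, and the counit condition kills the constant. *)
Lemma D_id_kernel (u : H2) : (forall T, D_id (ucm_dual K T) u = 0) ->
  lslice (@eps K M) u = 0 -> u = 0.
Proof.
move=> Du eu; apply/malgP => -[F G]; rewrite mcoeff0.
have rsE v : v@_(F, G) = (rslice (fun G' => (G' == G)%:R) v)@_F :> K.
  move: v; apply: (@malg_ext K _ K^o).
  - by move=> c v w; rewrite mcoeffD mcoeffZ.
  - by move=> c v w; rewrite linearP /= mcoeffD mcoeffZ.
  by case=> a b; rewrite rslice_mon mcoeffZ !mcoeff_mon /= -natrM mulnb xpair_eqE andbC.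
rewrite rsE (@D_kernel (rslice _ u)).
  rewrite mcoeffZ mon1 mcoeff_mon.
  suff -> : (rslice (fun G' => (G' == G)%:R) u)@_mone = (lslice (@eps K M) u)@_G.
    by rewrite eu mcoeff0 mul0r.
  move: u {Du eu rsE}; apply: (@malg_ext K _ K^o).
  - by move=> c v w; rewrite linearP /= mcoeffD mcoeffZ.
  - by move=> c v w; rewrite linearP /= mcoeffD mcoeffZ.
  by case=> a b; rewrite rslice_mon lslice_mon !mcoeffZ !mcoeff_mon epsE mulrC.
move=> T; have : rslice (fun G' => (G' == G)%:R) (D_id (ucm_dual K T) u) = 0.
  by rewrite Du linear0.
move=> <-; move: u {Du eu rsE}; apply: malg_ext.
- by move=> c v w; rewrite linearP /= linearP.
- by move=> c v w; rewrite linearP /= linearP.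
by case=> a b; rewrite D_id_mon rslice_tens rslice_mon linearZ lext_mon.
Qed.

End Kernel.

(** * The antipode *)

(** Iterating [step] more than [mu a] times no longer changes the value at [a], since [step] only
    reads values of smaller measure. *)
Lemma measure_rec (A V : Type) (mu : A -> nat) (v0 : V) (step : (A -> V) -> A -> V) :
  (forall g h a, (forall b, (mu b < mu a)%N -> g b = h b) -> step g a = step h a) ->
  exists g, forall a, g a = step g a.
Proof.
move=> stepP; pose s n := iter n step (fun=> v0).
have sE n a : (mu a < n)%N -> forall p, (mu a < p)%N -> s n a = s p a.
  elim: n a => // n IH a an [//|p] ap; apply: stepP => b ba.
  by apply: IH; [exact: leq_trans ba _ | exact: leq_trans ba _].
exists (fun a => s (mu a).+1 a) => a; apply: stepP => b ba; exact: sE.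
Qed.

(** Multiplication after f (x) g; on a coproduct this is the convolution product. *)
HB.lock Definition conv (K : fieldType) (M : conomType) (B : comAlgType K)
    (f g : {malg K[M]} -> B) (u : {malg K[(M * M)%type]}) : B :=
  lext (fun u => f (mon u.1) * g (mon u.2)) u.
Arguments conv {K M B}.

Section Convolution.
Variables (K : fieldType) (M : conomType) (B : comAlgType K).
Implicit Types (f g : {malg K[M]} -> B).

Lemma convE f g u : conv f g u = lext (fun u => f (mon u.1) * g (mon u.2)) u.
Proof. by rewrite unlock. Qed.

Lemma conv_is_linear f g : linear (conv f g).
Proof. by move=> c u v; rewrite !convE linearP. Qed.
HB.instance Definition _ f g :=
  GRing.isLinear.Build K {malg K[(M * M)%type]} B _ (conv f g) (conv_is_linear f g).

Lemma conv_mon f g u : conv f g (mon u) = f (mon u.1) * g (mon u.2).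
Proof. by rewrite convE lext_mon. Qed.

Lemma conv_tens f g x y : linear f -> linear g -> conv f g (tens x y) = f x * g y.
Proof.
move=> lf lg; move: x y; apply: malg_bilinear_ext.
- by move=> x c u v; rewrite !linearP.
- by move=> y c u v; rewrite tens_linearl linearP.
- by move=> x c u v; rewrite lg mulrDr scalerAr.
- by move=> y c u v; rewrite lf mulrDl scalerAl.
by move=> m n; rewrite tens_mon conv_mon.
Qed.

Lemma convM f g : {morph f : x y / x * y} -> {morph g : x y / x * y} ->
  {morph conv f g : u v / u * v}.
Proof.
move=> fM gM u v; rewrite !convE; apply: lextM => {}u {}v /=.
by rewrite -!monM fM gM mulrACA.
Qed.

End Convolution.

Section Antipode.
Variable K : fieldType.
Local Notation M := {cmonom rtree}.
Local Notation H := {malg K[M]}.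
Local Notation H3 := {malg K[(M * (M * M))%type]}.

Definition ungraft (T : rtree) : M := projT1 (cid (graft_surj T)).

Lemma ungraftK T : graft (ungraft T) = T.
Proof. by rewrite /ungraft; case: cid. Qed.

(** Encodes S (B+ F) = - (S * B+) (F). The recursion ends because the trees in the left factors of
    Delta F have size at most the weight of F, hence less than the size of B+ F. *)
Lemma antipode_rec_exists : exists s : rtree -> H,
  forall T, s T = - conv (lext (cmap s)) id (id_Bplus (Delta (mon (ungraft T)))).
Proof.
apply: (@measure_rec rtree H rtree_size 0 (fun s T =>
  - conv (lext (cmap s)) id (id_Bplus (Delta (mon (ungraft T)))))) => g h T gh.
suff E : conv (lext (cmap g)) id (id_Bplus (Delta (mon (ungraft T))))
       = conv (lext (cmap h)) id (id_Bplus (Delta (mon (ungraft T)))) :> H.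
  by rewrite E.
have := @Delta_homogeneous K (ungraft T); move: (Delta _) => u hu.
rewrite [u]malg_sumE !linear_sum big_seq [RHS]big_seq; apply: eq_bigr => -[F G] uu.
have E : cmap g F = cmap h F.
  rewrite !cmapE; apply: eq_big_seq => U UF; rewrite gh //.
  rewrite -[X in (_ < rtree_size X)%N]ungraftK rtree_size_graft ltnS.
  have /= <- := hu (F, G); last by rewrite mcoeff_neq0.
  by apply: leq_trans (leq_addr _ _); apply: leq_size_weight; rewrite cmE_neq0.
by rewrite !linearZ /= id_Bplus_mon !conv_mon /= !lext_mon E.
Qed.

Definition antipode_tree : rtree -> H := projT1 (cid antipode_rec_exists).

Definition antipode : H -> H := lext (cmap antipode_tree).
HB.instance Definition _ := GRing.Linear.on antipode.

Lemma antipode_linear : linear antipode.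
Proof. exact: lext_is_linear. Qed.

Lemma id_linear : linear (id : H -> H).
Proof. by []. Qed.

Lemma antipode_mon F : antipode (mon F) = cmap antipode_tree F.
Proof. exact: lext_mon. Qed.

Lemma antipode_treeE T : antipode_tree T =
  - conv antipode id (id_Bplus (Delta (mon (ungraft T)))).
Proof. exact: (projT2 (cid antipode_rec_exists)). Qed.

Lemma antipode1 : antipode 1 = 1.
Proof. exact: (lext1 (cmap1 _)). Qed.

Lemma antipodeM : {morph antipode : x y / x * y}.
Proof. exact: (lextM (cmapM _)). Qed.

Lemma conv_id_Bplus (f : H -> H) u : conv f id (id_Bplus u) = conv f (@Bplus K) u.
Proof.
move: u; apply: malg_ext.
- by move=> c u v; rewrite linearP /= linearP.
- by move=> c u v; rewrite linearP.
by move=> u; rewrite id_Bplus_mon !conv_mon Bplus_mon.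
Qed.

Lemma antipode_graft F : antipode (mon (ucm (graft F))) =
  - conv antipode (@Bplus K) (Delta (mon F)).
Proof.
rewrite antipode_mon cmapU antipode_treeE.
by rewrite (graft_inj (ungraftK (graft F))) -conv_id_Bplus.
Qed.

(** Convolving morphisms into a commutative algebra is multiplicative, so a single tree suffices;
    there the recursion for the antipode gives the cancellation. *)
Lemma antipode_l x : conv antipode id (Delta x) = x@_mone *: 1.
Proof.
move: x; apply: malg_ext.
- by move=> c u v; rewrite linearP /= linearP.
- by move=> c u v; rewrite mcoeffD mcoeffZ scalerDl scalerA.
move=> F; rewrite mcoeff_mon; elim/cmonom_ind: F => [|T F IH].
  by rewrite eqxx scale1r Delta_mon1 conv_mon /= -mon1 antipode1 mulr1.
have idM : {morph (id : H -> H) : x y / x * y} by [].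
rewrite -monM DeltaM (convM antipodeM idM) -(ungraftK T) Delta_graft.
rewrite (linearD (conv antipode id)) /=.
rewrite (conv_tens _ _ antipode_linear id_linear).
rewrite mulr1 antipode_graft.
rewrite conv_id_Bplus.
by rewrite addNr mul0r cmM_eq1 cm1_eq1 scale0r.
Qed.

(* [x (x) y (x) z |-> x S(y) B+(z)]: its values at both sides of the
   coassociativity relation compare [id * S] with [S * id]. *)
Definition antipode_bplus3 : H3 -> H :=
  lext (fun u => mon u.1 * (antipode (mon u.2.1) * Bplus (mon u.2.2))).
HB.instance Definition _ := GRing.Linear.on antipode_bplus3.

Lemma antipode_bplus3_mon u : antipode_bplus3 (mon u) =
  mon u.1 * (antipode (mon u.2.1) * Bplus (mon u.2.2)).
Proof. exact: lext_mon. Qed.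

Lemma antipode_bplus3_Delta_id v : antipode_bplus3 (Delta_id v) =
  lext (fun u => conv id antipode (Delta (mon u.1)) * Bplus (mon u.2)) v.
Proof.
move: v; apply: malg_ext.
- by move=> c u v; rewrite linearP /= linearP.
- by move=> c u v; rewrite linearP.
case=> F G; rewrite Delta_id_mon lext_mon /=; move: (Delta _); apply: malg_ext.
- by move=> c u v; rewrite reassoc_linearl linearP.
- by move=> c u v; rewrite linearP mulrDl -scalerAl.
by move=> u; rewrite reassoc_mon antipode_bplus3_mon conv_mon mulrA.
Qed.

Lemma antipode_bplus3_id_Delta v : antipode_bplus3 (id_Delta v) =
  - lext (fun u => mon u.1 * antipode (Bplus (mon u.2))) v.
Proof.
suff E : - antipode_bplus3 (id_Delta v)
       = lext (fun u => mon u.1 * antipode (Bplus (mon u.2))) v by rewrite -E opprK.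
move: v; apply: malg_ext.
- by move=> c u v; rewrite linearP /= linearP opprD scalerN.
- by move=> c u v; rewrite linearP.
case=> F G; rewrite id_Delta_mon lext_mon /= Bplus_mon antipode_graft mulrN.
suff -> : antipode_bplus3 (tens (mon F) (Delta (mon G)))
  = mon F * conv antipode (@Bplus K) (Delta (mon G)) by [].
move: (Delta _); apply: malg_ext.
- by move=> c u v; rewrite linearP /= linearP.
- by move=> c u v; rewrite linearP mulrDr -scalerAr.
by move=> u; rewrite tens_mon antipode_bplus3_mon conv_mon.
Qed.

(** Strong induction on the weight. The antipode of B+ F is opened with its recursion, and
    coassociativity moves the convolution to left factors of Delta F, of weight less than that of B+
    F. *)
Lemma antipode_r x : conv id antipode (Delta x) = x@_mone *: 1.
Proof.
move: x; apply: malg_ext.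
- by move=> c u v; rewrite linearP /= linearP.
- by move=> c u v; rewrite mcoeffD mcoeffZ scalerDl scalerA.
have idM : {morph (id : H -> H) : x y / x * y} by [].
move=> F; rewrite mcoeff_mon; have [n] := ubnP (weight F).
elim: n F => // n IHn F; rewrite ltnS => Fn.
have Fn' T : (F : M) T != 0%N -> (rtree_size T <= n)%N.
  by move=> /leq_size_weight h; exact: leq_trans h Fn.
elim/cmonom_ind: F {Fn} Fn' => [_|T F IH Tn].
  by rewrite eqxx scale1r Delta_mon1 conv_mon /= -mon1 antipode1 mulr1.
rewrite -monM DeltaM (convM idM antipodeM) cmM_eq1 cm1_eq1 scale0r.
suff -> : conv id antipode (Delta (mon (ucm T))) = 0 :> H by rewrite mul0r.
have {Tn IH} : (rtree_size T <= n)%N by apply: Tn; rewrite cmM cmUU.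
rewrite -(ungraftK T); move: (ungraft T) => {}F; rewrite rtree_size_graft => Fn.
rewrite Delta_graft (linearD (conv id antipode)) /=.
rewrite (conv_tens _ _ id_linear antipode_linear).
rewrite antipode1 mulr1.
have -> : conv id antipode (id_Bplus (Delta (mon F)))
  = lext (fun u => mon u.1 * antipode (Bplus (mon u.2))) (Delta (mon F)) :> H.
  move: (Delta _); apply: malg_ext.
  - by move=> c u v; rewrite linearP /= linearP.
  - by move=> c u v; rewrite linearP.
  by move=> u; rewrite id_Bplus_mon conv_mon lext_mon Bplus_mon.
rewrite -[X in _ + X]opprK -antipode_bplus3_id_Delta -coassoc antipode_bplus3_Delta_id.
suff -> : lext (fun u => conv id antipode (Delta (mon u.1)) * Bplus (mon u.2))
            (Delta (mon F)) = mon (ucm (graft F)) :> H by rewrite subrr.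
(* The induction hypothesis turns the convolution on the left factor into the counit. *)
transitivity (lslice (@eps K M) (id_Bplus (Delta (mon F)))); last first.
  by rewrite lslice_id_Bplus counit_l Bplus_mon.
have := @Delta_homogeneous K F; move: (Delta _) => v hv.
rewrite [v]malg_sumE !linear_sum big_seq [RHS]big_seq; apply: eq_bigr => -[a b] vab.
rewrite !linearZ /= id_Bplus_mon lslice_mon lext_mon /= epsE; congr (_ *: _).
rewrite IHn; first by rewrite Bplus_mon -scalerAl mul1r.
apply: leq_ltn_trans Fn; have /= <- := hv (a, b); last by rewrite mcoeff_neq0.
exact: leq_addr.
Qed.

End Antipode.

(** * The recursion for the generators *)

Section StructureRecursion.
Variable K : fieldType.
Hypothesis K0 : [pchar K] =i pred0.
Variable B : comAlgType K.
Variable L : nat -> nat -> K.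
Implicit Types (c : nat -> B) (i j k m n p : nat).

Lemma natrS_neq0 n : n.+1%:R != 0 :> K.
Proof. by rewrite ((pcharf0P K).1 K0). Qed.

(** The equation of q divided by [m], a division undone in [qE] by characteristic zero; its right
    side only involves smaller second indices. *)
Lemma q_exists c i : exists q : nat -> B, forall m, q m =
  if m == 0%N then 1 else
  m%:R^-1 *: \sum_(j < m) L (i + (m - j.+1)) j.+1 *: (c j.+1 * q (m - j.+1)%N).
Proof.
apply: (@measure_rec nat B id 0 (fun q m => if m == 0%N then 1 else
  m%:R^-1 *: \sum_(j < m) L (i + (m - j.+1)) j.+1 *: (c j.+1 * q (m - j.+1)%N))).
move=> g h [|m] gh //=; congr (_ *: _); apply: eq_bigr => j _.
by rewrite gh // subSS ltnS leq_subr.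
Qed.

Definition q c i : nat -> B := projT1 (cid (q_exists c i)).

Lemma q0 c i : q c i 0 = 1.
Proof. by rewrite /q; case: cid => /= f ->. Qed.

Lemma qE c i m : m%:R *: q c i m =
  \sum_(j < m) L (i + (m - j.+1)) j.+1 *: (c j.+1 * q c i (m - j.+1)%N).
Proof.
case: m => [|m]; first by rewrite big_ord0 scale0r.
rewrite /q; case: cid => /= f fE.
by rewrite {1}fE /= scalerA divff ?scale1r // natrS_neq0.
Qed.

Lemma q_eq c i m x :
  m.+1%:R *: x = \sum_(j < m.+1) L (i + (m.+1 - j.+1)) j.+1 *:
    (c j.+1 * q c i (m.+1 - j.+1)%N) -> x = q c i m.+1.
Proof. by rewrite -qE => /(scalerI (natrS_neq0 m)). Qed.

(** This lets [c] and [q] be built together by one recursion on [c]. *)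
Lemma q_local c c' i m : (forall j, (0 < j <= m)%N -> c j = c' j) ->
  q c i m = q c' i m.
Proof.
have [n] := ubnP m; elim: n m => // n IH [|m]; first by rewrite !q0.
rewrite ltnS => mn cc'; apply: q_eq; rewrite qE; apply: eq_bigr => j _.
rewrite cc' ?IH //; first by rewrite subSS; apply: leq_ltn_trans mn; exact: leq_subr.
  by move=> h /andP[h0 hm]; rewrite cc' // h0 (leq_trans hm) ?leq_subr.
exact: ltn_ord.
Qed.

Section Generation.
Variable bp : B -> B.

(* Recursion making [q_gen0] hold: [c n.+1] occurs with coefficient 1 in
   [n.+1%:R *: q c 0 n.+1] since [L 0 n.+1 = 1]. *)
Lemma c_exists : exists c, forall n, c n.+1 = n.+1%:R *: bp (q c 1 n) -
  \sum_(j < n) L (n.+1 - j.+1) j.+1 *: (c j.+1 * q c 0 (n.+1 - j.+1)%N).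
Proof.
have [|c cE] := @measure_rec nat B id 0 (fun c n =>
    if n is m.+1 then m.+1%:R *: bp (q c 1 m) -
      \sum_(j < m) L (m.+1 - j.+1) j.+1 *: (c j.+1 * q c 0 (m.+1 - j.+1)%N)
    else 0); last by exists c => n; exact: (cE n.+1).
move=> g h [//|n] gh; rewrite (@q_local g h); last by move=> j /andP[_ jn]; exact: gh.
congr (_ - _); apply: eq_bigr => j _; have jn := ltn_ord j.
rewrite gh // (@q_local g h) // => p /andP[_ pn]; apply: gh; apply: leq_ltn_trans pn _.
by rewrite subSS ltnS leq_subr.
Qed.

Definition c_gen : nat -> B := projT1 (cid c_exists).

Lemma c_genE n : c_gen n.+1 = n.+1%:R *: bp (q c_gen 1 n) -
  \sum_(j < n) L (n.+1 - j.+1) j.+1 *: (c_gen j.+1 * q c_gen 0 (n.+1 - j.+1)%N).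
Proof. exact: (projT2 (cid c_exists)). Qed.

Hypothesis L0 : forall n, L 0 n.+1 = 1.

Lemma q_gen0 n : q c_gen 0 n.+1 = bp (q c_gen 1 n).
Proof.
apply/esym/q_eq; rewrite big_ord_recr /= subnn addn0 L0 q0 mulr1 scale1r.
by rewrite [X in _ + X]c_genE addrC subrK.
Qed.

End Generation.

(** * Graded properties inherited by c and q *)

Section Closure.
Variable P : nat -> B -> Prop.
Hypothesis P1 : P 0 1.
Hypothesis P0 : forall n, P n 0.
Hypothesis PD : forall n x y, P n x -> P n y -> P n (x + y).
Hypothesis PZ : forall n b x, P n x -> P n (b *: x).
Hypothesis PM : forall m n x y, P m x -> P n y -> P (m + n) (x * y).

Lemma closed_sum n p (F : 'I_p -> B) : (forall j : 'I_p, P n (F j)) -> P n (\sum_j F j).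
Proof. by move=> PF; elim/big_ind: _ => // x y; exact: PD. Qed.

Lemma closed_q c i m : (forall j, (0 < j <= m)%N -> P j (c j)) -> P m (q c i m).
Proof.
have [n] := ubnP m; elim: n m => // n IH [|m]; first by rewrite q0.
rewrite ltnS => mn Pc; suff : P m.+1 (m.+1%:R^-1 *: (m.+1%:R *: q c i m.+1)).
  by rewrite scalerA mulVf ?scale1r // natrS_neq0.
apply: PZ; rewrite qE; apply: closed_sum => j; apply: PZ; have jm := ltn_ord j.
have -> : P m.+1 = P (j.+1 + (m.+1 - j.+1))%N by rewrite subnKC.
apply: PM; first exact: Pc.
apply: IH => [|h /andP[h0 hm]].
  by rewrite subSS; apply: leq_ltn_trans mn; exact: leq_subr.
by apply: Pc; rewrite h0 (leq_trans hm) ?leq_subr.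
Qed.

(** In the equation for q_(0,n+1), c_(n+1) has coefficient [L 0 n.+1 = 1], so it equals a multiple
    of q_(0,n+1) minus terms built from c_1, ..., c_n. *)
Lemma closed_c c n : L 0 n.+1 = 1 -> (forall j, (0 < j <= n)%N -> P j (c j)) ->
  P n.+1 (q c 0 n.+1) -> P n.+1 (c n.+1).
Proof.
move=> L0 Pc Pq; have := qE c 0 n.+1.
rewrite big_ord_recr /= subnn addn0 L0 q0 mulr1 scale1r => /eqP.
rewrite addrC -subr_eq => /eqP <-; apply: PD; first exact: PZ.
rewrite -scaleN1r; apply: (PZ (-1)); apply: closed_sum => j; apply: PZ.
have jn := ltn_ord j; have -> : P n.+1 = P (j.+1 + (n.+1 - j.+1))%N.
  by rewrite subnKC // ltnS ltnW.
apply: PM; first exact: Pc.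
apply: closed_q => h /andP[h0 hm]; apply: Pc.
by rewrite h0 (leq_trans hm) // subSS leq_subr.
Qed.

End Closure.

(** The index [i] may be 0, so that the relation also covers the elements [q c 0 m]. *)
Definition prelie : Prop := forall i j k, (0 < j)%N -> (0 < k)%N ->
  L i j * L (i + j) k - L j k * L i (j + k)
  = L i k * L (i + k) j - L k j * L i (j + k).

Hypothesis L_prelie : prelie.

(* For [T] of size [k] and [a] the coefficient of [T] in [t_k], [D_T] sends
   [q c i m] to [a *: dq c k i m] and [c j] to [a *: dc c k j]. *)
Definition dq c k i m : B :=
  if (k <= m)%N then L (i + (m - k)) k *: q c i (m - k)%N else 0.

Definition dc c k j : B :=
  if j == k then k%:R *: 1
  else if (k < j)%N then (L (j - k) k - L k (j - k)) *: c (j - k)%N else 0.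

(** The left side is what the Leibniz rule yields on the right side of [qE]; the pre-Lie relation
    makes the recursion consistent with the prescribed derivatives. *)
Lemma dq_rec c k i m : (0 < k)%N ->
  \sum_(j < m) L (i + (m - j.+1)) j.+1 *:
    (dc c k j.+1 * q c i (m - j.+1)%N + c j.+1 * dq c k i (m - j.+1)%N)
  = m%:R *: dq c k i m.
Proof.
move=> k0; rewrite /dq; case: leqP => [km|mk]; last first.
  rewrite scaler0 big1 // => j _; have jm := ltn_ord j.
  rewrite /dc (ltn_eqF (leq_ltn_trans jm mk)) ltnNge (leq_trans jm (ltnW mk)) /=.
  by rewrite leqNgt (leq_ltn_trans (leq_subr _ _) mk) /= mul0r mulr0 addr0 scaler0.
have [p mE] : exists p, m = (k + p)%N by exists (m - k)%N; rewrite subnKC.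
rewrite {km}mE addKn; under eq_bigr do rewrite scalerDr; rewrite big_split /=.
(* Terms where [c] is differentiated: those with j+1 < k vanish, j+1 = k gives the multiple of
   q_(i,p), and the others are reindexed by j = k + r. *)
have -> : \sum_(j < k + p) L (i + (k + p - j.+1)) j.+1 *:
      (dc c k j.+1 * q c i (k + p - j.+1)%N)
  = (L (i + p) k * k%:R) *: q c i p + \sum_(r < p)
     (L (i + (p - r.+1)) (k + r.+1) * (L r.+1 k - L k r.+1)) *:
       (c r.+1 * q c i (p - r.+1)%N).
  rewrite big_split_ord /=; congr (_ + _).
    case: k k0 => // k _; rewrite big_ord_recr /= big1 ?add0r => [|j _].
      by rewrite addKn /dc eqxx -scalerAl mul1r scalerA.
    have jk : (j.+1 < k.+1)%N by rewrite ltnS ltn_ord.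
    by rewrite /dc (ltn_eqF jk) ltnNge (ltnW jk) mul0r scaler0.
  apply: eq_bigr => r _; rewrite -addnS subnDl /dc gtn_eqF; last first.
    by rewrite addnS ltnS leq_addr.
  by rewrite addnS ltnS leq_addr -addnS addKn -scalerAl scalerA.
(* Terms where [q] is differentiated: for j >= p the remaining degree is less than [k] and [dq]
   vanishes. *)
have -> : \sum_(j < k + p) L (i + (k + p - j.+1)) j.+1 *:
      (c j.+1 * (if (k <= k + p - j.+1)%N
        then L (i + (k + p - j.+1 - k)) k *: q c i (k + p - j.+1 - k)%N else 0))
  = \sum_(r < p) (L (i + (p - r.+1) + k) r.+1 * L (i + (p - r.+1)) k) *:
       (c r.+1 * q c i (p - r.+1)%N).
  rewrite [(k + p)%N]addnC big_split_ord /= [X in _ + X]big1 ?addr0 => [|j _].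
    apply: eq_bigr => r _; rewrite -addnBAC // leq_addl addnK addnA.
    by rewrite -scalerAr scalerA.
  rewrite -addnS subnDl leqNgt ltn_subrL k0 /= mulr0 scaler0 //.
rewrite -addrA -big_split /=.
have -> : \sum_(r < p) ((L (i + (p - r.+1)) (k + r.+1) * (L r.+1 k - L k r.+1)) *:
       (c r.+1 * q c i (p - r.+1)%N)
     + (L (i + (p - r.+1) + k) r.+1 * L (i + (p - r.+1)) k) *:
       (c r.+1 * q c i (p - r.+1)%N)) = L (i + p) k *: (p%:R *: q c i p).
  rewrite qE scaler_sumr; apply: eq_bigr => r _; rewrite -scalerDl scalerA.
  congr (_ *: _); set s := (i + (p - r.+1))%N.
  have -> : (i + p = s + r.+1)%N by rewrite /s -addnA subnK ?ltn_ord.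
  (* The pre-Lie relation at s, r+1, k merges both coefficients into [L (i + p) k] times the
     coefficient appearing in [qE]. *)
  have := @L_prelie s r.+1 k isT k0; rewrite [(r.+1 + k)%N]addnC => e.
  have := congr1 (fun x => x + L r.+1 k * L s (k + r.+1)) e; rewrite subrK => e'.
  by rewrite [RHS]mulrC e'; ring.
by rewrite !scalerA -scalerDl natrD; congr (_ *: _); ring.
Qed.

Section Derivation.
Variables (D : B -> B) (a : K) (c : nat -> B) (k : nat).
Hypothesis D_lin : linear D.
Hypothesis D_der : forall x y, D (x * y) = D x * y + x * D y.
Hypothesis k0 : (0 < k)%N.

Lemma derivation_scale b x : D (b *: x) = b *: D x.
Proof.
have D0 : D 0 = 0 by have := D_lin (-1) 0 0; rewrite scaler0 addr0 scaleN1r addNr.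
by rewrite -[b *: x]addr0 D_lin D0 addr0.
Qed.

Lemma derivation_add x y : D (x + y) = D x + D y.
Proof. by rewrite -[x in LHS]scale1r D_lin scale1r. Qed.

Lemma derivation_sum (n : nat) (F : 'I_n -> B) : D (\sum_j F j) = \sum_j D (F j).
Proof.
elim/big_ind2: _ => //; last by move=> x x' y y' <- <-; rewrite derivation_add.
by have := derivation_scale 0 0; rewrite !scale0r.
Qed.

Lemma derivation1 : D 1 = 0.
Proof.
by have := D_der 1 1; rewrite !mulr1 mul1r => /eqP; rewrite -subr_eq subrr => /eqP<-.
Qed.

(** Leibniz rule on [qE], induction for lower degrees, then [dq_rec]; the factor [m] is cancelled at
    the end. *)
Lemma derivation_q i m : (forall j, (0 < j <= m)%N -> D (c j) = a *: dc c k j) ->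
  D (q c i m) = a *: dq c k i m.
Proof.
have [n] := ubnP m; elim: n m => // n IH [|m].
  by rewrite q0 derivation1 /dq leqn0 gtn_eqF // scaler0.
rewrite ltnS => mn Dc; apply: (scalerI (natrS_neq0 m)).
rewrite scalerA mulrC -scalerA -dq_rec // -derivation_scale qE derivation_sum scaler_sumr.
apply: eq_bigr => j _; have jm := ltn_ord j.
rewrite derivation_scale D_der Dc; last by rewrite jm.
rewrite IH; first by rewrite -scalerAl -scalerAr -scalerDr !scalerA mulrC.
  by rewrite subSS; apply: leq_ltn_trans mn; exact: leq_subr.
by move=> h /andP[h0 hm]; rewrite Dc // h0 (leq_trans hm) ?leq_subr.
Qed.

(** Between [D] of the equation for q_(0,n+1) and [dq_rec], all terms but the last agree; the last
    one isolates the derivative of c_(n+1). *)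
Lemma derivation_c n : L 0 n.+1 = 1 ->
  (forall j, (0 < j <= n)%N -> D (c j) = a *: dc c k j) ->
  D (q c 0 n.+1) = a *: dq c k 0 n.+1 -> D (c n.+1) = a *: dc c k n.+1.
Proof.
move=> L0 Dc Dq; have := congr1 D (qE c 0 n.+1).
rewrite derivation_scale Dq scalerA mulrC -scalerA -dq_rec // derivation_sum scaler_sumr.
rewrite !big_ord_recr /= subnn q0 !mulr1 addn0 L0 !scale1r.
rewrite /dq leqn0 gtn_eqF // mulr0 addr0.
set S := \sum_(j < n) _; set S' := \sum_(j < n) _.
suff -> : S = S' by move/addrI.
apply: eq_bigr => j _; have jn := ltn_ord j.
rewrite derivation_scale D_der Dc // derivation_q; last first.
  move=> h /andP[h0 hm]; rewrite Dc // h0 (leq_trans hm) // subSS; exact: leq_subr.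
by rewrite -scalerAl -scalerAr -scalerDr !scalerA mulrC.
Qed.

End Derivation.

End StructureRecursion.

(** * From sequences to coefficients *)

Local Open Scope classical_set_scope.

Section TreeCombinations.
Variable K : fieldType.
Hypothesis K0 : [pchar K] =i pred0.
Local Notation M := {cmonom rtree}.
Local Notation H := {malg K[M]}.

Lemma supp_in_ind (N : choiceType) (P : N -> Prop) (Q : {malg K[N]} -> Prop) x :
  supp_in P x -> Q 0 -> (forall c m y, P m -> Q y -> Q (c *: mon m + y)) -> Q x.
Proof.
move=> Px Q0 QD; rewrite [x]malg_sumE big_seq.
elim/big_rec: _ => // m y mx Qy; apply: QD => //.
by apply: Px; rewrite mcoeff_neq0.
Qed.

Definition is_tree_of_size n (F : M) : Prop := exists T, F = ucm T /\ rtree_size T = n.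

Definition tree_comb n (x : H) : Prop := supp_in (is_tree_of_size n) x.

Lemma tree_comb_homogeneous n x : tree_comb n x -> homogeneous n x.
Proof. by apply: supp_in_sub => _ [T [-> <-]]; rewrite weightU. Qed.

Lemma tree_comb_mone n x : tree_comb n x -> x@_mone = 0.
Proof.
move=> hx; apply/eqP; apply: contraT => /hx[T [/eqP]].
by rewrite eq_sym cm1_eq1.
Qed.

Lemma tree_comb_neq0 n x : tree_comb n x -> x != 0 ->
  exists2 T, rtree_size T = n & x@_(ucm T) != 0.
Proof.
move=> hx; apply: contra_neqP => nT; apply: supp_in_eq0 => F xF.
have [T [FT Tn]] := hx _ xF; apply: nT; exists T => //; by rewrite -FT.
Qed.

Lemma tree_comb_coeff n x T : tree_comb n x -> rtree_size T != n -> x@_(ucm T) = 0.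
Proof.
move=> /tree_comb_homogeneous hx Tn; apply/eqP; apply: contraNT Tn => /hx.
by rewrite weightU => ->.
Qed.

Lemma mcoeff_Bplus x F : (Bplus x)@_(ucm (graft F)) = x@_F :> K.
Proof.
move: x; apply: (@malg_ext K _ K^o).
- by move=> c u v; rewrite (linearP (@Bplus K)) /= mcoeffD mcoeffZ.
- by move=> c u v; rewrite mcoeffD mcoeffZ.
move=> G; rewrite Bplus_mon !mcoeff_mon; congr (nat_of_bool _)%:R.
apply/eqP/eqP => [/(congr1 (fun m : M => m (graft F)))|-> //].
by rewrite !cmU eqxx; case: eqP => // /graft_inj.
Qed.

Lemma Bplus_eq0 x : Bplus x = 0 :> H -> x = 0.
Proof. by move=> B0; apply/malgP => F; rewrite -mcoeff_Bplus B0 !mcoeff0. Qed.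

Lemma D_Bplus (f : M -> K) x :
  D f (Bplus x) = (lext (f : M -> K^o) (Bplus x) : K) *: 1 + Bplus (D f x).
Proof. by rewrite !DE Delta_Bplus linearD /= lslice_tens lslice_id_Bplus. Qed.

Lemma tree_comb_Bplus n x : homogeneous n x -> tree_comb n.+1 (Bplus x).
Proof.
move=> hx; apply: (supp_in_lext hx) => F <-; apply: supp_in_mon.
by exists (graft F); rewrite rtree_size_graft.
Qed.

Lemma tree_comb_is_Bplus n x : tree_comb n.+1 x ->
  exists2 w, homogeneous n w & x = Bplus w.
Proof.
move=> hx.
apply: (supp_in_ind (Q := fun x => exists2 w, homogeneous n w & x = Bplus w) hx).
  by exists 0; [exact: supp_in0 | rewrite linear0].
move=> c _ y [T [-> Tn]] [w hw ->]; have [F TF] := graft_surj T.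
exists (c *: mon F + w); last by rewrite linearP /= Bplus_mon -TF.
apply: supp_inD => //; apply: supp_inZ; apply: supp_in_mon.
by move: Tn; rewrite TF rtree_size_graft => -[].
Qed.

(** Write x = B+ w. For T smaller than n, the constant in [D_Bplus] vanishes by degree and B+ is
    injective, so D_T w = 0; for larger T this holds by degree. Hence w is constant, and zero
    because its degree n-1 is positive. *)
Lemma tree_comb_eq0 n x : tree_comb n x -> (1 < n)%N ->
  (forall T, (rtree_size T < n)%N -> D (ucm_dual K T) x = 0) -> x = 0.
Proof.
case: n => // n /[dup] hBw /tree_comb_is_Bplus[w hw xE] n0 Dx.
rewrite xE in hBw Dx *; suff -> : w = 0 by rewrite linear0.
have Dw T : D (ucm_dual K T) w = 0.
  have [Tn|nT] := ltnP (rtree_size T) n.+1; last first.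
    rewrite (D_ucm_dual_large hw); last exact: ltnW.
    suff -> : w@_(ucm T) = 0 by rewrite scale0r.
    apply/eqP; apply: contraTT nT => /hw; rewrite weightU => ->.
    by rewrite ltnn.
  apply: Bplus_eq0; have := Dx T Tn; rewrite D_Bplus lext_ucm_dual.
  by rewrite (tree_comb_coeff hBw) ?scale0r ?add0r // ltn_eqF.
rewrite (D_kernel K0 Dw); suff -> : w@_mone = 0 by rewrite scale0r.
apply/eqP; apply: contraTT n0 => /hw; rewrite weight1 => <-.
by [].
Qed.

End TreeCombinations.

(** * Linear spans and generated subalgebras *)

Section SpanAndSubalgebra.
Variable K : fieldType.

Lemma lin_span_sub (V : lmodType K) (G A : set V) :
  GRing.submod_closed (mem A) -> G `<=` A -> lin_span G `<=` A.
Proof. by move=> cA GA x; apply. Qed.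

Lemma lin_span_closed (V : lmodType K) (G : set V) : GRing.submod_closed (mem (lin_span G)).
Proof.
split=> [|c x y]; first by apply/mem_set => A [[A0 _] _]; exact: set_mem A0.
move=> /set_mem hx /set_mem hy; apply/mem_set => A hA; have [[_ AD] _] := hA.
by apply: set_mem; apply: AD; apply/mem_set; [exact: hx | exact: hy].
Qed.

Lemma lin_span_gen (V : lmodType K) (G : set V) : G `<=` lin_span G.
Proof. by move=> x Gx A [_]; exact. Qed.

Lemma gen_subalgebra_sub (B : lalgType K) (G A : set B) :
  subalgebra A -> G `<=` A -> gen_subalgebra G `<=` A.
Proof. by move=> cA GA x; apply. Qed.

Lemma gen_subalgebra_closed (B : lalgType K) (G : set B) :
  subalgebra (gen_subalgebra G).
Proof.
split=> [|c x y|x y]; first by apply/mem_set => A [[A1 _ _] _]; exact: set_mem A1.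
  move=> /set_mem hx /set_mem hy; apply/mem_set => A hA; have [[_ AD _] _] := hA.
  by apply: set_mem; apply: AD; apply/mem_set; [exact: hx | exact: hy].
move=> /set_mem hx /set_mem hy; apply/mem_set => A hA; have [[_ _ AM] _] := hA.
by apply: set_mem; apply: AM; apply/mem_set; [exact: hx | exact: hy].
Qed.

Lemma gen_subalgebra_gen (B : lalgType K) (G : set B) : G `<=` gen_subalgebra G.
Proof. by move=> x Gx A [_]; exact. Qed.

Lemma lin_span_trees n (x : {malg K[{cmonom rtree}]}) :
  lin_span [set (htree K T : HCK K) | T in [set T | rtree_size T = n]] x <->
  tree_comb n x.
Proof.
split=> [|hx].
  apply: lin_span_sub => [|_ [T /= Tn <-]]; last first.
    by rewrite /htree /hforest mkmalgU_mon; apply: supp_in_mon; exists T.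
  split=> [|c u v]; first by apply/mem_set; exact: supp_in0.
  move=> /set_mem hu /set_mem hv; apply/mem_set.
  by apply: supp_inD => //; apply: supp_inZ.
have [s0 sD] := lin_span_closed [set (htree K T : HCK K) | T in [set T | rtree_size T = n]].
set S := lin_span _; apply: (supp_in_ind (Q := S) hx); first exact: set_mem s0.
move=> c _ y [T [-> Tn]] /mem_set hy; apply: set_mem; apply: sD => //.
apply/mem_set; apply: lin_span_gen; exists T => //.
exact: mkmalgU_mon.
Qed.

End SpanAndSubalgebra.

Lemma posint_split (n : posint) j : (0 < j < val n)%N ->
  exists2 k : posint, j = val k & exists i, n = posint_add i k.
Proof.
move=> /andP[j0 jn]; exists (exist _ j j0) => //.
have ij : (0 < val n - j)%N by rewrite subn_gt0.
by exists (exist (fun m => 0 < m)%N _ ij); apply: val_inj; rewrite /= subnK // ltnW.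
Qed.

Lemma scaler_injr (K : fieldType) (V : lmodType K) (v : V) (x y : K) :
  v != 0 -> x *: v = y *: v -> x = y.
Proof.
move=> v0 /eqP; rewrite -subr_eq0 -scalerBl scaler_eq0 (negbTE v0) orbF subr_eq0.
by move/eqP.
Qed.

(** * Structure coefficients of a sequence in [Seq] *)

Section Forward.
Variable K : fieldType.
Hypothesis K0 : [pchar K] =i pred0.
Local Notation M := {cmonom rtree}.
Local Notation H := {malg K[M]}.
Local Notation H2 := {malg K[(M * M)%type]}.
Local Notation P := {cmonom posint}.
Local Infix "+p" := posint_add (at level 50, left associativity).

Definition tens_ext (t : posint -> H) : {malg K[(P * P)%type]} -> H2 :=
  lext (fun u => tens (cmap t u.1) (cmap t u.2)).
HB.instance Definition _ t := GRing.Linear.on (tens_ext t).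

Lemma tens_ext_mon t u : tens_ext t (mon u) = tens (cmap t u.1) (cmap t u.2).
Proof. exact: lext_mon. Qed.

Lemma tens_ext_tens t x y :
  tens_ext t (tens x y) = tens (lext (cmap t) x) (lext (cmap t) y).
Proof.
move: x y; apply: malg_bilinear_ext.
- by move=> x c u v; rewrite !linearP.
- by move=> y c u v; rewrite tens_linearl linearP.
- by move=> x c u v; rewrite !linearP.
- by move=> y c u v; rewrite linearP tens_linearl.
by move=> m n; rewrite tens_mon tens_ext_mon !lext_mon.
Qed.

Lemma tens_map_alg_ext (t : posint -> HCK K) y :
  tens_map (alg_ext t) (alg_ext t) y = tens_ext t y :> H2.
Proof.
have E m : alg_ext t << m >> = cmap (t : posint -> H) m :> H.
  rewrite mkmalgU_mon; transitivity (lext (cmap (t : posint -> H)) (mon m)).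
    exact: alg_extE.
  exact: lext_mon.
rewrite [RHS]lextE; apply: eq_bigr => u _.
exact: (f_equal2 (fun a b => y@_u *: (tens a b : H2)) (E u.1) (E u.2)).
Qed.

Section SeqTheory.
Variable t : posint -> H.
Hypothesis tS : @Seq K t.

Lemma Seq_neq0 n : t n != 0.
Proof. by case: tS => /(_ n)[]. Qed.

Lemma Seq_tree_comb n : tree_comb (val n) (t n).
Proof. by case: tS => /(_ n)[_ h] _ _; apply/lin_span_trees. Qed.

Lemma Seq_mone n : (t n)@_mone = 0.
Proof. exact: tree_comb_mone (@Seq_tree_comb n). Qed.

Lemma Seq_subalgebra x : @gen_subalgebra K (HCK K) (range t) x ->
  exists p, x = lext (cmap t) p.
Proof.
apply: (gen_subalgebra_sub (A := [set x | exists p, x = lext (cmap t) p])); last first.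
  by move=> _ [n _ <-]; exists (mon (ucm n)); rewrite lext_mon cmapU.
split=> [|c u v|u v].
- by apply/mem_set; exists 1; rewrite (lext1 (cmap1 _)).
- move=> /set_mem[p ->] /set_mem[p' ->]; apply/mem_set; exists (c *: p + p').
  by rewrite linearP.
move=> /set_mem[p ->] /set_mem[p' ->]; apply/mem_set; exists (p * p').
by rewrite (lextM (cmapM _)).
Qed.

(** The Hopf condition puts the coproduct in the span of tensors of elements of the subalgebra,
    which are polynomials in the [t n]. *)
Lemma Seq_expansion n : exists y, tens_ext t y = Delta (t n).
Proof.
case: tS => _ _ [_ + _] => /(_ (comul (t n : HCK K))) h.
have {h} : lin_span [set (tens a b : HCK2 K) | a in @gen_subalgebra K (HCK K) (range t)
                                             & b in @gen_subalgebra K (HCK K) (range t)]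
             (comul (t n : HCK K)).
  by apply: h; exists (t n) => //; apply: gen_subalgebra_gen; exists n.
rewrite comulE.
apply: (lin_span_sub (A := [set x | exists y, tens_ext t y = x])); last first.
  move=> _ [a ha [b hb <-]]; have [p ->] := Seq_subalgebra ha.
  have [p' ->] := Seq_subalgebra hb; exists (tens p p'); exact: tens_ext_tens.
split=> [|c u v]; first by apply/mem_set; exists 0; rewrite linear0.
move=> /set_mem[p <-] /set_mem[p' <-]; apply/mem_set; exists (c *: p + p').
by rewrite linearP.
Qed.

Definition expansion n : {malg K[(P * P)%type]} :=
  xget 0 (@expansions K t (comul (t n : HCK K))).

Lemma expansionE n : tens_ext t (expansion n) = Delta (t n).
Proof.
have [y yE] := Seq_expansion n.
have : @expansions K t (comul (t n : HCK K)) (expansion n).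
  apply: xgetPex; exists y; rewrite /expansions /= comulE -yE.
  exact: tens_map_alg_ext.
by rewrite /expansions /= comulE => <-; rewrite tens_map_alg_ext.
Qed.

Local Notation l := (@structure_coef K t).

Lemma structure_coefE i j : l i j = (expansion (i +p j))@_(ucm j, ucm i).
Proof. by []. Qed.

Lemma cmap_mone (m : P) : (cmap t m)@_mone = eps K m.
Proof.
elim/cmonom_ind: m => [|i m IH].
  by rewrite cmap1 eps1 mon1 mcoeff_mon eqxx.
by rewrite cmapM cmapU rmorphM /= Seq_mone mul0r epsM eps_ucm mul0r.
Qed.

(** As the [t n] have no constant term, [f] pulled back to monomials in them is still infinitesimal,
    hence fixed by its values on the variables. *)
Lemma infinitesimal_cmap (f : M -> K) j (a : K) : infinitesimal f ->
  lext (f : M -> K^o) (t j) = a ->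
  (forall m, m != j -> lext (f : M -> K^o) (t m) = 0) ->
  forall m : P, lext (f : M -> K^o) (cmap t m) = a * ucm_dual K j m.
Proof.
move=> inf_f fja fj.
apply: (@infinitesimal_unique K posint (fun m => lext (f : M -> K^o) (cmap t m) : K)
  (fun m => a * ucm_dual K j m)) => [m m'|m m'|i].
- by rewrite cmapM infinitesimalM // !cmap_mone.
- by rewrite ucm_dual_infinitesimal; ring.
rewrite cmapU ucm_dualE; have [->|ij] := eqVneq i j; first by rewrite eqxx mulr1.
rewrite fj // (_ : (ucm i == ucm j) = false) ?mulr0 //.
apply: contraNF ij => /eqP/(congr1 (fun m : P => m j)).
by rewrite !cmU eqxx; case: eqP.
Qed.

(** Contraction with [f] retains only the terms whose left factor is t_j. *)
Lemma D_expansion (f : M -> K) j n : infinitesimal f ->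
  (forall m, m != j -> lext (f : M -> K^o) (t m) = 0) ->
  D f (t n) = (lext (f : M -> K^o) (t j) : K) *:
    lext (cmap t) (lslice (ucm_dual K j) (expansion n)).
Proof.
move=> inf_f fj; rewrite DE -expansionE; move: (expansion n).
apply: malg_ext.
- by move=> c u v; rewrite linearP /= linearP.
- by move=> c u v; rewrite linearP /= linearP scalerDr !scalerA mulrC.
move=> u; rewrite tens_ext_mon lslice_tens lslice_mon linearZ /= lext_mon scalerA.
by rewrite (infinitesimal_cmap inf_f erefl fj).
Qed.

Lemma ucm_dual_neq T (j : posint) : rtree_size T = val j ->
  forall m, m != j -> lext (ucm_dual K T : M -> K^o) (t m) = 0.
Proof.
move=> Tj m mj; rewrite lext_ucm_dual (tree_comb_coeff (@Seq_tree_comb m)) //.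
by apply: contra_neq mj => Tm; apply: val_inj; rewrite /= -Tm Tj.
Qed.

Lemma mcoeff_lslice U (i j : posint) y : rtree_size U = val i ->
  (lext (cmap t) (lslice (ucm_dual K j) y))@_(ucm U)
  = y@_(ucm j, ucm i) * (t i)@_(ucm U).
Proof.
move=> Ui; rewrite -[LHS]lext_ucm_dual; move: y; apply: (@malg_ext K _ K^o).
- by move=> c u v; rewrite (linearP (lslice _)) linearP /= linearP.
- by move=> c u v; rewrite mcoeffD mcoeffZ mulrDl -mulrA.
case=> a b; rewrite lslice_mon linearZ /= lext_mon linearZ /=.
rewrite (infinitesimal_cmap (ucm_dual_infinitesimal K U) erefl (ucm_dual_neq Ui)).
rewrite lext_ucm_dual mcoeff_mon xpair_eqE -mulnb natrM !ucm_dualE /GRing.scale /=.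
by rewrite mulrA mulrAC.
Qed.

(** By degree and [D_is_tree], the left side is a combination of trees of size i, so comparing the
    coefficients of these trees is enough. *)
Lemma D_Seq T (i j : posint) : rtree_size T = val j ->
  D (ucm_dual K T) (t (i +p j)) = ((t j)@_(ucm T) * l i j) *: t i.
Proof.
move=> Tj; have inf_T := ucm_dual_infinitesimal K T.
have DT := D_expansion (i +p j) inf_T (ucm_dual_neq Tj).
have hD : tree_comb (val i) (D (ucm_dual K T) (t (i +p j))).
  have hij := @Seq_tree_comb (i +p j).
  move=> F DF; have := D_ucm_dual_homogeneous (T := T) (tree_comb_homogeneous hij) DF.
  rewrite Tj (_ : val (i +p j) = (val i + val j)%N) // => /addIn Fi.
  have ht : supp_in is_tree (t (i +p j)).
    by apply: supp_in_sub hij => _ [U [-> _]]; exists U.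
  have [F1|[U FU]] := D_is_tree ht DF.
    exfalso; have : (0 < val i)%N := valP i.
    by rewrite -Fi F1 weight1.
  by exists U; split=> //; rewrite -weightU -FU.
apply/malgP => F; have [[U [-> Ui]]|nF] := pselect (is_tree_of_size (val i) F); last first.
  have z x : tree_comb (val i) x -> x@_F = 0.
    by move=> hx; apply/eqP; apply: contraT => /hx.
  rewrite z // z //; apply: supp_inZ; exact: (@Seq_tree_comb i).
rewrite DT [LHS]mcoeffZ [RHS]mcoeffZ (mcoeff_lslice _ _ Ui).
by rewrite lext_ucm_dual structure_coefE mulrA.
Qed.

(** By [D_expansion] the result depends on [f] only through a scalar factor; a tree with nonzero
    coefficient in t_j identifies the remaining slice. *)
Lemma D_Seq_infinitesimal (f : M -> K) i j : infinitesimal f ->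
  (forall m, m != j -> lext (f : M -> K^o) (t m) = 0) ->
  D f (t (i +p j)) = ((lext (f : M -> K^o) (t j) : K) * l i j) *: t i.
Proof.
move=> inf_f fj; have [T Tj aT] := tree_comb_neq0 (@Seq_tree_comb j) (Seq_neq0 j).
have := D_expansion (i +p j) (ucm_dual_infinitesimal K T) (ucm_dual_neq Tj).
rewrite (D_Seq _ Tj) lext_ucm_dual -[LHS]scalerA => /(scalerI aT) e.
by rewrite (D_expansion _ inf_f fj) -e [LHS]scalerA.
Qed.

Lemma structure_coef_prelie i j k :
  l i j * l (i +p j) k - l j k * l i (j +p k)
  = l i k * l (i +p k) j - l k j * l i (j +p k).
Proof.
move: (structure_coef t) D_Seq D_Seq_infinitesimal => lam DS DSi.
have [T Tj aT] := tree_comb_neq0 (@Seq_tree_comb j) (Seq_neq0 j).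
have [U Uk bU] := tree_comb_neq0 (@Seq_tree_comb k) (Seq_neq0 k).
set a := (t j)@_(ucm T) in aT; set b := (t k)@_(ucm U) in bU.
(* [f] and [g] are the convolutions [T^* * U^*] and [U^* * T^*], so that [D h] is
   the commutator of [D_U] and [D_T]. *)
pose f F : K := lext (ucm_dual K U : M -> K^o) (D (ucm_dual K T) (mon F)).
pose g F : K := lext (ucm_dual K T : M -> K^o) (D (ucm_dual K U) (mon F)).
pose h F : K := f F - g F.
have fE x : lext (f : M -> K^o) x = (D (ucm_dual K T) x)@_(ucm U).
  by rewrite -lext_ucm_dual -(lext_unique (f := fun x => lext (ucm_dual K U : M -> K^o)
    (D (ucm_dual K T) x) : K^o)) // => c u v; rewrite !linearP.
have gE x : lext (g : M -> K^o) x = (D (ucm_dual K U) x)@_(ucm T).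
  by rewrite -lext_ucm_dual -(lext_unique (f := fun x => lext (ucm_dual K T : M -> K^o)
    (D (ucm_dual K U) x) : K^o)) // => c u v; rewrite !linearP.
have hE x : lext (h : M -> K^o) x =
    (D (ucm_dual K T) x)@_(ucm U) - (D (ucm_dual K U) x)@_(ucm T).
  by rewrite -fE -gE; exact: (lextB (V := K^o)).
have eD V F : (D (ucm_dual K V) (mon F))@_mone = ucm_dual K V F.
  by rewrite counit_D lext_mon.
(* The mixed terms are symmetric in [V] and [W]; they cancel in [h], which is therefore
   infinitesimal. *)
have inf_fg V W F G : lext (ucm_dual K W : M -> K^o) (D (ucm_dual K V) (mon (mmul F G))) =
    lext (ucm_dual K W : M -> K^o) (D (ucm_dual K V) (mon F)) * eps K G
    + ucm_dual K V F * ucm_dual K W G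
    + (ucm_dual K W F * ucm_dual K V G
       + eps K F * lext (ucm_dual K W : M -> K^o) (D (ucm_dual K V) (mon G))).
  rewrite -monM D_derivation; last exact: ucm_dual_infinitesimal.
  have iW := ucm_dual_infinitesimal K W.
  rewrite (linearD (lext _)) /= [X in X + _ = _](infinitesimalM _ _ iW).
  by rewrite [X in _ + X = _](infinitesimalM _ _ iW) !eD !lext_mon !mcoeff_mon -!epsE.
have fM F G : f (mmul F G) = f F * eps K G + ucm_dual K T F * ucm_dual K U G
    + (ucm_dual K U F * ucm_dual K T G + eps K F * f G) := inf_fg T U F G.
have gM F G : g (mmul F G) = g F * eps K G + ucm_dual K U F * ucm_dual K T G
    + (ucm_dual K T F * ucm_dual K U G + eps K F * g G) := inf_fg U T F G.
have inf_h : infinitesimal h.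
  by move=> F G; rewrite /h fM gM; clearbody f g; ring.
have Dh x : D h x =
    D (ucm_dual K U) (D (ucm_dual K T) x) - D (ucm_dual K T) (D (ucm_dual K U) x).
  rewrite !D_D !DE !lsliceE -lextB; apply: eq_lext => u.
  by rewrite scalerBl.
(* By degree [h] only sees t_(j+k), so that [D_Seq_infinitesimal] applies to it. *)
have hj m : m != j +p k -> lext (h : M -> K^o) (t m) = 0.
  move=> mjk; rewrite hE; have hm := tree_comb_homogeneous (@Seq_tree_comb m).
  suff z V W : (rtree_size W + rtree_size V)%N != val m ->
      (D (ucm_dual K V) (t m))@_(ucm W) = 0.
    have mjk' : val m != (val j + val k)%N by apply: contra_neq mjk => e; exact: val_inj.
    by rewrite !z ?subrr // ?Tj ?Uk eq_sym // addnC.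
  move=> VW; apply/eqP; apply: contraNT VW => /(D_ucm_dual_homogeneous hm).
  by rewrite weightU => ->.
have e1 : i +p (j +p k) = (i +p k) +p j.
  by apply: val_inj; rewrite /= [(_ + val k)%N in LHS]addnC addnA.
have e2 : i +p (j +p k) = (i +p j) +p k by apply: val_inj; rewrite /= addnA.
have e3 : j +p k = k +p j by apply: val_inj; rewrite /= addnC.
have hjk : lext (h : M -> K^o) (t (j +p k)) = a * b * (lam k j - lam j k).
  have E1 : (D (ucm_dual K T) (t (j +p k)))@_(ucm U) = a * lam k j * b.
    by rewrite e3 (DS _ _ _ Tj) mcoeffZ.
  have E2 : (D (ucm_dual K U) (t (j +p k)))@_(ucm T) = b * lam j k * a.
    by rewrite (DS _ _ _ Uk) mcoeffZ.
  by rewrite hE E1 E2; ring.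
have E1 : D (ucm_dual K U) (D (ucm_dual K T) (t (i +p (j +p k))))
    = (a * lam (i +p k) j * (b * lam i k)) *: t i.
  rewrite e1 (DS _ _ _ Tj) linearZ /= (DS _ _ _ Uk) [LHS]scalerA; exact: erefl.
have E2 : D (ucm_dual K T) (D (ucm_dual K U) (t (i +p (j +p k))))
    = (b * lam (i +p j) k * (a * lam i j)) *: t i.
  rewrite e2 (DS _ _ _ Uk) linearZ /= (DS _ _ _ Tj) [LHS]scalerA; exact: erefl.
have E3 : D h (t (i +p (j +p k))) = (a * b * (lam k j - lam j k) * lam i (j +p k)) *: t i.
  rewrite (DSi _ i _ inf_h hj) hjk; exact: erefl.
(* Both evaluations of the commutator are multiples of the nonzero t_i, so their scalars agree;
   dividing by [a] and [b] gives the relation. *)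
have e := Dh (t (i +p (j +p k))); rewrite E1 E2 E3 -[RHS]scalerBl in e.
have {}e := scaler_injr (Seq_neq0 i) e.
apply: (mulfI aT); apply: (mulfI bU).
have -> : b * (a * (lam i j * lam (i +p j) k - lam j k * lam i (j +p k)))
  = b * lam (i +p j) k * (a * lam i j) - a * b * lam j k * lam i (j +p k) by ring.
have -> : b * (a * (lam i k * lam (i +p k) j - lam k j * lam i (j +p k)))
  = a * lam (i +p k) j * (b * lam i k) - a * b * lam k j * lam i (j +p k) by ring.
apply/eqP; rewrite -subr_eq0; apply/eqP.
transitivity (a * b * (lam k j - lam j k) * lam i (j +p k)
  - (a * lam (i +p k) j * (b * lam i k) - b * lam (i +p j) k * (a * lam i j))); first by ring.
by rewrite e subrr.
Qed.

(** If all these coefficients vanished, every D_T with T smaller than n would kill t_n,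
    contradicting [tree_comb_eq0]. *)
Lemma structure_coef_nondegenerate (n : posint) : (2 <= val n)%N ->
  exists i j, i +p j = n /\ l i j != 0.
Proof.
move=> n2; apply: contrapT => nl; have := Seq_neq0 n.
rewrite (tree_comb_eq0 K0 (@Seq_tree_comb n)) ?eqxx //.
move=> T Tn; have [|j Tj [i ni]] := @posint_split n (rtree_size T).
  by rewrite rtree_size_gt0.
rewrite ni (D_Seq _ Tj); suff -> : l i j = 0 by rewrite mulr0 scale0r.
by apply/eqP; apply: contraT => lij; case: nl; exists i, j.
Qed.

Lemma Seq_posint1 : t posint1 = mon (ucm bullet).
Proof. by case: tS => _ -> _; exact: mkmalgU_mon. Qed.

End SeqTheory.

Lemma structure_coef_Lambda (t : posint -> H) :
  @Seq K t -> @Lambda K (@structure_coef K t).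
Proof.
move=> tS; split; first exact: structure_coef_prelie.
exact: structure_coef_nondegenerate.
Qed.

(** By strong induction, [D_Seq] shows that D_T kills the difference of the n-th terms for T smaller
    than n; the first term is always the bullet. *)
Lemma structure_coef_inj (t t' : posint -> H) : @Seq K t -> @Seq K t' ->
  @structure_coef K t = @structure_coef K t' -> t = t'.
Proof.
move=> tS tS' tt'; have e i j : @structure_coef K t i j = @structure_coef K t' i j.
  by rewrite tt'.
move=> {tt'}; apply/funext => n; have [m] := ubnP (val n).
elim: m n => // m IH n; rewrite ltnS => nm.
have [n1|n2] := leqP (val n) 1.
  have -> : n = posint1.
    by apply: val_inj; apply/eqP; rewrite eqn_leq n1 (valP n).
  exact: (etrans (Seq_posint1 tS) (esym (Seq_posint1 tS'))).
have hn : tree_comb (val n) (t n - t' n).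
  rewrite -scaleN1r; apply: supp_inD; first exact: (@Seq_tree_comb _ tS n).
  by apply: supp_inZ; exact: (@Seq_tree_comb _ tS' n).
apply: subr0_eq; apply: (tree_comb_eq0 K0 hn) => // T Tn.
have [|j Tj [i ni]] := @posint_split n (rtree_size T).
  by rewrite rtree_size_gt0.
have nE : val n = (val i + val j)%N by rewrite ni.
have im : (val i < m)%N.
  by apply: leq_trans nm; rewrite nE -addn1 leq_add2l; exact: valP j.
have jm : (val j < m)%N.
  by apply: leq_trans nm; rewrite nE -add1n leq_add2r; exact: valP i.
rewrite linearB /= ni (D_Seq tS _ Tj) (D_Seq tS' _ Tj) e (IH i im) (IH j jm).
by rewrite subrr.
Qed.

End Forward.

(** * From coefficients to sequences *)

Section Construction.
Variable K : fieldType.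
Hypothesis K0 : [pchar K] =i pred0.
Local Notation M := {cmonom rtree}.
Local Notation H := {malg K[M]}.
Local Notation H2 := {malg K[(M * M)%type]}.
Variable L : nat -> nat -> K.
Hypothesis L_prelie : prelie L.
Hypothesis L0 : forall n, L 0 n.+1 = 1.
Variable c : nat -> H.
Local Notation Q := (q L c).
Hypothesis Q_Bplus : forall n, Q 0 n.+1 = Bplus (Q 1 n).

(** Homogeneity of c_1, ..., c_n passes to q_(1,n), then to q_(0,n+1) = B+ q_(1,n), and [closed_c]
    returns it to c_(n+1). *)
Lemma c_homogeneous n : homogeneous n.+1 (c n.+1).
Proof.
have P1 : homogeneous 0 (1 : H) := @homogeneous1 K.
have P0 m : homogeneous m (0 : H) by exact: supp_in0.
have PD m (x y : H) : homogeneous m x -> homogeneous m y -> homogeneous m (x + y).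
  exact: supp_inD.
have PZ m b (x : H) : homogeneous m x -> homogeneous m (b *: x) by exact: supp_inZ.
have PM m p (x y : H) : homogeneous m x -> homogeneous p y -> homogeneous (m + p) (x * y).
  exact: homogeneousM.
have [m] := ubnP n; elim: m n => // m IH n; rewrite ltnS => nm.
have hc j : (0 < j <= n)%N -> homogeneous j (c j).
  by case: j => // j /= jn; apply: IH; exact: leq_trans jn nm.
apply: (closed_c K0 (P := fun n => @homogeneous K n) P1 P0 PD PZ PM (L0 n) hc).
rewrite Q_Bplus; apply: tree_comb_homogeneous; apply: tree_comb_Bplus.
exact: (closed_q K0 (P := fun n => @homogeneous K n) L P1 P0 PD PZ PM 1 hc).
Qed.

Lemma Q_homogeneous i m : homogeneous m (Q i m).
Proof.
apply: (closed_q K0 (P := fun n => @homogeneous K n) L).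
- exact: homogeneous1.
- by move=> n; exact: supp_in0.
- by move=> n x y; exact: supp_inD.
- by move=> n b x; exact: supp_inZ.
- by move=> n p x y; exact: homogeneousM.
by case=> // j _; exact: c_homogeneous.
Qed.

Lemma Q_tree_comb n : tree_comb n.+1 (Q 0 n.+1).
Proof. by rewrite Q_Bplus; apply: tree_comb_Bplus; exact: Q_homogeneous. Qed.

Lemma Q_mone i m : (Q i m)@_mone = (m == 0%N)%:R.
Proof.
case: m => [|m]; first by rewrite q0 mon1 mcoeff_mon !eqxx.
apply/eqP; apply: contraT => /(@Q_homogeneous i m.+1); by rewrite weight1.
Qed.

Lemma DeltaZ b x : Delta (b *: x) = b *: Delta x :> H2.
Proof. exact: linearZ. Qed.

Lemma BplusZ b x : Bplus (b *: x) = b *: Bplus x :> H.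
Proof. exact: linearZ. Qed.

Section CoordinateDerivation.
Variable T : rtree.
Local Notation k := (rtree_size T).
Local Notation a := ((Q 0 k)@_(ucm T)).

Lemma D_T_linear : linear (D (ucm_dual K T)).
Proof. exact: linearP. Qed.

Lemma D_T_derivation x y : D (ucm_dual K T) (x * y) =
  D (ucm_dual K T) x * y + x * D (ucm_dual K T) y.
Proof. exact: D_derivation (ucm_dual_infinitesimal K T). Qed.

(** Same circuit as for homogeneity: from q_(1,n) to q_(0,n+1) by [D_Bplus], then to c_(n+1) by
    [derivation_c]. *)
Lemma D_c n : D (ucm_dual K T) (c n.+1) = a *: dc L c k n.+1.
Proof.
have k0 := rtree_size_gt0 T.
have [m] := ubnP n; elim: m n => // m IH n; rewrite ltnS => nm.
have hc j : (0 < j <= n)%N -> D (ucm_dual K T) (c j) = a *: dc L c k j.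
  by case: j => // j /= jn; apply: IH; exact: leq_trans jn nm.
apply: (derivation_c K0 L_prelie D_T_linear D_T_derivation k0 (L0 n) hc).
rewrite Q_Bplus D_Bplus lext_ucm_dual -Q_Bplus.
rewrite (derivation_q K0 L_prelie D_T_linear D_T_derivation k0 1 hc) /dq.
(* The constant in [D_Bplus] is the coefficient of T in q_(0,n+1); it can be nonzero only for k =
   n+1, where it is the whole derivative. *)
have [kn|nk|nk] := ltngtP k n.+1.
- have kn' : (k <= n)%N by rewrite -ltnS.
  rewrite kn' (tree_comb_coeff (@Q_tree_comb n)); last by rewrite ltn_eqF.
  rewrite scale0r add0r BplusZ BplusZ -Q_Bplus add0n add1n (subSn kn'); exact: erefl.
- have kn : (k <= n)%N = false by rewrite leqNgt (ltnW nk).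
  rewrite kn (tree_comb_coeff (@Q_tree_comb n)); last by rewrite gtn_eqF.
  by rewrite scaler0 scale0r (linear0 (@Bplus K)) addr0.
have kn : (k <= n)%N = false by rewrite nk ltnn.
rewrite kn scaler0 (linear0 (@Bplus K)) addr0 nk subnn addn0 L0 q0 scale1r; exact: erefl.
Qed.

Lemma D_Q i m : D (ucm_dual K T) (Q i m) = a *: dq L c k i m.
Proof.
apply: (derivation_q K0 L_prelie D_T_linear D_T_derivation (rtree_size_gt0 T)).
by case=> // j _; exact: D_c.
Qed.

End CoordinateDerivation.

(** By [D_id_kernel] it suffices to apply the counit and D_T to the left factors. On q_(i+l,m-l),
    D_T gives the scalar [L (i + (m - k)) k] whatever l is, so the induction hypothesis at degree
    m-k concludes. *)
Lemma Delta_Q i m : Delta (Q i m) = \sum_(l < m.+1) tens (Q (i + l) (m - l)) (Q i l).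
Proof.
have [n] := ubnP m; elim: n m => // n IH m; rewrite ltnS => mn.
set S := \sum_(l < _) _.
apply: subr0_eq; apply: (D_id_kernel K0) => [T|]; last first.
  rewrite (linearB (lslice _)) /= counit_l.
  suff -> : lslice (@eps K M) S = Q i m by rewrite subrr.
  rewrite /S (linear_sum (lslice _)) big_ord_recr /= subnn.
  rewrite [X in _ + X]lslice_tens lext_eps Q_mone eqxx mulr1n scale1r big1 ?add0r // => j _.
  by rewrite lslice_tens lext_eps Q_mone subn_eq0 leqNgt ltn_ord scale0r.
have k0 := rtree_size_gt0 T; set k := rtree_size T in k0.
rewrite (linearB (D_id _)) /= -Delta_D D_Q DeltaZ.
rewrite /S (linear_sum (D_id _)) /=.
set a := _@_(ucm T).
have -> : \sum_(l < m.+1) D_id (ucm_dual K T) (tens (Q (i + l) (m - l)) (Q i l))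
  = a *: \sum_(l < m.+1) tens (dq L c k (i + l) (m - l)) (Q i l).
  rewrite scaler_sumr; apply: eq_bigr => l _; by rewrite D_id_tens D_Q tensZl.
rewrite -scalerBr; apply/eqP; rewrite scaler_eq0; apply/orP; right; apply/eqP.
rewrite {1}/dq; case: leqP => [km|mk]; last first.
  rewrite (linear0 (@Delta K)) big1 ?subrr // => l _; rewrite /dq leqNgt.
  by rewrite (leq_ltn_trans (leq_subr _ _) mk) tens0l.
rewrite DeltaZ IH; last first.
  by apply: leq_trans mn; rewrite ltn_subrL k0 (leq_trans k0 km).
have [p mE] : exists p, m = (p + k)%N by exists (m - k)%N; rewrite subnK.
(* For l > p the left factor has degree less than [k] and its derivative vanishes. *)
rewrite {km}mE addnK -addSn big_split_ord /= [X in _ - (_ + X)]big1 ?addr0 => [|l _].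
  rewrite scaler_sumr -sumrB big1 // => l _.
  have lp : (l <= p)%N by rewrite -ltnS.
  rewrite /dq -addnBAC // leq_addl addnK -addnA subnKC //.
  by rewrite tensZl subrr.
rewrite /dq addSnnS subnDl leqNgt ltn_subrL k0 /=.
by rewrite tens0l.
Qed.

End Construction.

(** * The antipode in terms of the definitions of the statement *)

Section HopfStructure.
Variable K : fieldType.
Local Notation M := {cmonom rtree}.
Local Notation H := {malg K[M]}.
Local Notation H2 := {malg K[(M * M)%type]}.

Lemma tens_mul_tens_map (f g : H -> H) (z : H2) :
  @tens_mul K forest (@tens_map K forest forest forest forest f g z) = conv f g z.
Proof.
have mulE (w : H2) : @tens_mul K forest w = lext (fun u => mon (mmul u.1 u.2)) w :> H.
  by rewrite lextE; apply: eq_bigr => u _; rewrite mkmalgU_scale_mon.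
have mapE : @tens_map K forest forest forest forest f g z
    = lext (fun u => tens (f (mon u.1)) (g (mon u.2))) z :> H2.
  rewrite lextE; apply: eq_bigr => u _.
  exact: (f_equal2 (fun a b => z@_u *: (tens (f a) (g b) : H2))
    (mkmalgU_mon K u.1) (mkmalgU_mon K u.2)).
rewrite mulE mapE linear_lext convE; apply: eq_lext => u.
move: (f _) (g _); apply: malg_bilinear_ext.
- by move=> x c v w; rewrite !linearP.
- by move=> y c v w; rewrite tens_linearl linearP.
- by move=> x c v w; rewrite mulrDr -scalerAr.
- by move=> y c v w; rewrite mulrDl -scalerAl.
by move=> F G /=; rewrite tens_mon lext_mon monM.
Qed.

Lemma counitE (x : H) : @counit K x = x@_mone.
Proof.
rewrite /counit (@alg_extE rtree K K^o (fun=> 0)); move: x; apply: (@malg_ext K _ K^o).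
- by move=> a u v; rewrite linearP.
- by move=> a u v; rewrite mcoeffD mcoeffZ.
move=> F; rewrite lext_mon mcoeff_mon.
elim/cmonom_ind: F => [|T F IH]; first by rewrite cmap1 eqxx.
by rewrite cmapM cmapU mul0r cmM_eq1 cm1_eq1.
Qed.

Lemma antipode_is_antipode :
  @is_antipode K (@antipode K : {linear HCK K -> HCK K}).
Proof.
move=> x; rewrite comulE counitE; split.
  exact: etrans (tens_mul_tens_map _ _ _) (antipode_l x).
exact: etrans (tens_mul_tens_map _ _ _) (antipode_r x).
Qed.

End HopfStructure.

(** * The sequence attached to an element of [Lambda] *)

Section Surjectivity.
Variable K : fieldType.
Hypothesis K0 : [pchar K] =i pred0.
Local Notation M := {cmonom rtree}.
Local Notation H := {malg K[M]}.
Local Notation H2 := {malg K[(M * M)%type]}.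
Local Infix "+p" := posint_add (at level 50, left associativity).
Variable l : posint -> posint -> K.
Hypothesis lL : Lambda l.

(* The index [0] stands for the unit: [t_0 = 1] and [lambda_(0,j) = 1]; the value
   at [j = 0] is never used. *)
Definition extend_coef (i j : nat) : K :=
  if insub j is Some j' then
    if insub i is Some i' then l (i' : posint) (j' : posint) else 1
  else 0.

Local Notation L := extend_coef.

Lemma extend_coefE (i j : posint) : L (val i) (val j) = l i j.
Proof.
have E (k : posint) : insub (val k) = Some k :> option posint := valK k.
by rewrite /extend_coef !E.
Qed.

Lemma extend_coef0 n : L 0 n.+1 = 1.
Proof. by rewrite /extend_coef insubT // insubF. Qed.

(** For i = 0 both sides vanish, as L is 1 there; otherwise this is the relation in [Lambda]. *)
Lemma extend_coef_prelie : prelie L.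
Proof.
move=> i j k j0 k0; have [lP _] := lL.
pose j' : posint := exist _ j j0; pose k' : posint := exist _ k k0.
case: i => [|i].
  by rewrite -(prednK j0) -(prednK k0) !extend_coef0 ?addSn ?extend_coef0 add0n; ring.
pose i' : posint := exist (fun n => 0 < n)%N i.+1 isT.
have := lP i' j' k'; rewrite -!extend_coefE; exact.
Qed.

Let c : nat -> H := c_gen K0 L (@Bplus K).
Local Notation Q := (q L c).

Let Q_Bplus n : Q 0 n.+1 = Bplus (Q 1 n).
Proof. exact: (q_gen0 K0 (@Bplus K) extend_coef0). Qed.

Let D_t T n : D (ucm_dual K T) (Q 0 n) =
  (Q 0 (rtree_size T))@_(ucm T) *: dq L c (rtree_size T) 0 n.
Proof. exact: (D_Q K0 extend_coef_prelie extend_coef0 Q_Bplus). Qed.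

Let t (n : posint) : H := Q 0 (val n).

Let t_tree_comb n : tree_comb (val n) (t n).
Proof.
rewrite /t; case: n => -[//|n] n0 /=.
exact: (Q_tree_comb K0 extend_coef0 Q_Bplus).
Qed.

Let D_t_add T (i j : posint) : rtree_size T = val j ->
  D (ucm_dual K T) (t (i +p j)) = ((t j)@_(ucm T) * l i j) *: t i.
Proof.
move=> Tj; rewrite /t D_t Tj /dq leq_addl addnK add0n extend_coefE [LHS]scalerA.
exact: erefl.
Qed.

(** Non-degeneracy gives i + j = n with [l i j] nonzero; for T with nonzero coefficient in t_j, D_T
    t_n is then a nonzero multiple of t_i. *)
Let t_neq0 n : t n != 0.
Proof.
have [m] := ubnP (val n); elim: m n => // m IH n; rewrite ltnS => nm.
have [n1|n2] := leqP (val n) 1.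
  have n1' : val n = 1%N by apply/eqP; rewrite eqn_leq n1; exact: valP n.
  rewrite /t n1' Q_Bplus q0 mon1 Bplus_mon.
  apply/eqP => /(congr1 (mcoeff (ucm (graft mone)))).
  by rewrite mcoeff_mon eqxx mcoeff0 => /eqP; rewrite oner_eq0.
have [_ /(_ n n2)[i [j [ijn lij]]]] := lL.
have nE : val n = (val i + val j)%N by rewrite -ijn.
have im : (val i < m)%N.
  by apply: leq_trans nm; rewrite nE -addn1 leq_add2l; exact: valP j.
have jm : (val j < m)%N.
  by apply: leq_trans nm; rewrite nE -add1n leq_add2r; exact: valP i.
have [T Tj aT] := tree_comb_neq0 (@t_tree_comb j) (IH j jm).
apply/eqP => tn0; have := D_t_add i Tj; rewrite ijn tn0 (linear0 (D _)) => /esym/eqP.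
by rewrite scaler_eq0 mulf_eq0 (negbTE aT) (negbTE lij) (negbTE (IH i im)).
Qed.

Let A : set (HCK K) := @gen_subalgebra K (HCK K) (range (t : posint -> HCK K)).

Let A1 : A (1 : H).
Proof. by have [A1 _ _] := @gen_subalgebra_closed K (HCK K) (range t); exact: set_mem A1. Qed.

Let AD (b : K) (x y : H) : A x -> A y -> A (b *: x + y).
Proof.
have [_ AD _] := @gen_subalgebra_closed K (HCK K) (range t).
by move=> /mem_set Ax /mem_set Ay; apply: set_mem; exact: AD.
Qed.

Let AM (x y : H) : A x -> A y -> A (x * y).
Proof.
have [_ _ AM] := @gen_subalgebra_closed K (HCK K) (range t).
by move=> /mem_set Ax /mem_set Ay; apply: set_mem; exact: AM.
Qed.

Let A0 : A (0 : H).
Proof. by rewrite -(addNr (1 : H)) -scaleN1r; apply: AD. Qed.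

Let At n : A (t n).
Proof. by apply: gen_subalgebra_gen; exists n. Qed.

Section ClosedSubset.
Variable P : H -> Prop.
Hypothesis P1 : P 1.
Hypothesis P0 : P 0.
Hypothesis PD : forall b x y, P x -> P y -> P (b *: x + y).
Hypothesis PM : forall x y, P x -> P y -> P (x * y).

(* [closed_q] and [closed_c] are about graded predicates; here the degree is
   ignored. *)
Let PD' (n : nat) x y : P x -> P y -> P (x + y).
Proof. by move=> Px Py; rewrite -[x]scale1r; exact: PD. Qed.

Let PZ (n : nat) b x : P x -> P (b *: x).
Proof. by move=> Px; rewrite -[b *: x]addr0; exact: PD. Qed.

Let PM' (m n : nat) x y : P x -> P y -> P (x * y).
Proof. exact: PM. Qed.

Lemma subalgebra_Q i m : (forall j, (0 < j <= m)%N -> P (c j)) -> P (Q i m).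
Proof.
exact: (closed_q K0 L (P := fun _ x => P x) P1 (fun=> P0) PD' PZ PM' i).
Qed.

(** The hypothesis may use the earlier [c j], which lets [P_rec] treat the antipode by induction. *)
Lemma subalgebra_c n :
  (forall m, (m <= n)%N -> (forall j, (0 < j <= m)%N -> P (c j)) -> P (Q 0 m.+1)) ->
  forall j, (0 < j <= n.+1)%N -> P (c j).
Proof.
elim: n => [|n IH] PQ j /andP[j0].
  rewrite leq_eqVlt orbC ltnS leqNgt j0 => /eqP ->.
  apply: (closed_c K0 (P := fun _ x => P x) P1 (fun=> P0) PD' PZ PM' (extend_coef0 0)).
    by move=> h /andP[h0 h1]; move: (leq_trans h0 h1).
  by apply: PQ => // h /andP[h0 h1]; move: (leq_trans h0 h1).
have Pc : forall j, (0 < j <= n.+1)%N -> P (c j).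
  by apply: IH => m mn; apply: PQ; exact: leq_trans mn _.
rewrite leq_eqVlt => /orP[/eqP ->|jn]; last by apply: Pc; rewrite j0.
apply: (closed_c K0 (P := fun _ x => P x) P1 (fun=> P0) PD' PZ PM' (extend_coef0 n.+1) Pc).
exact: PQ.
Qed.

End ClosedSubset.

Let Ac j : (0 < j)%N -> A (c j).
Proof.
move=> j0; apply: (subalgebra_c (P := fun x => A x) A1 A0 AD AM (n := j.-1)) => [m _ _|].
  exact: (At (exist (fun n => 0 < n)%N m.+1 isT)).
by rewrite j0 prednK /=.
Qed.

Let AQ i m : A (Q i m).
Proof.
apply: (subalgebra_Q (P := fun x => A x) A1 A0 AD AM) => j /andP[j0 _]; exact: Ac.
Qed.

Let TT : set (HCK2 K) := [set (tens a b : HCK2 K) | a in A & b in A].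
Let S (x : H2) : Prop := lin_span TT x.

Let SD b (x y : H2) : S x -> S y -> S (b *: x + y).
Proof.
have [_ h] := lin_span_closed TT.
by move=> /mem_set Sx /mem_set Sy; apply: set_mem; exact: h.
Qed.

Let S0 : S 0.
Proof. by have [h _] := lin_span_closed TT; exact: set_mem h. Qed.

Let S_tens (x y : H) : A x -> A y -> S (tens x y).
Proof. by move=> Ax Ay; apply: lin_span_gen; exists x => //; exists y. Qed.

(** Two successive inductions on the span, ending with two pure tensors. *)
Let SM (x y : H2) : S x -> S y -> S (x * y).
Proof.
move=> Sx; move: x Sx y.
apply: (lin_span_sub (A := [set x | forall y : H2, S y -> S ((x : H2) * y)])).
  split=> [|b u v].
    by apply/mem_set => y _; have -> : 0 * y = 0 :> H2 := mul0r y.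
  move=> /set_mem hu /set_mem hv; apply/mem_set => y Sy.
  have -> : (b *: u + v) * y = b *: ((u : H2) * y) + (v : H2) * y :> H2.
    by rewrite mulrDl -scalerAl.
  by apply: SD; [exact: hu | exact: hv].
move=> _ [a Aa [b Ab <-]].
apply: (lin_span_sub (A := [set y | S (tens (a : H) (b : H) * (y : H2))])).
  split=> [|e u v].
    apply/mem_set; exact: (eq_ind_r S S0 (mulr0 (tens (a : H) (b : H)))).
  move=> /set_mem hu /set_mem hv; apply/mem_set.
  have E : tens (a : H) (b : H) * (e *: (u : H2) + (v : H2))
      = e *: (tens (a : H) (b : H) * (u : H2)) + tens (a : H) (b : H) * (v : H2).
    by rewrite mulrDr -scalerAr.
  exact: (eq_ind_r S (SD e hu hv) E).
move=> _ [a' Aa' [b' Ab' <-]].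
exact: (eq_ind_r S (S_tens (AM Aa Aa') (AM Ab Ab')) (tensM (a : H) a' (b : H) b')).
Qed.

Let S1 : S 1.
Proof. by rewrite -tens11; exact: S_tens. Qed.

Let S_sum p (F : 'I_p -> H2) : (forall j : 'I_p, S (F j)) -> S (\sum_j F j).
Proof.
move=> SF; elim/big_ind: _ => // x y Sx Sy; rewrite -[x]scale1r; exact: SD.
Qed.

Let comul_A : @comul K @` A `<=` lin_span TT.
Proof.
move=> _ [x Ax <-]; rewrite comulE; move: x Ax.
apply: (gen_subalgebra_sub (A := [set x | S (Delta x)])); last first.
  move=> _ [n _ <-]; rewrite /= /t.
  rewrite (Delta_Q K0 extend_coef_prelie extend_coef0 Q_Bplus).
  by apply: S_sum => j; apply: S_tens; exact: AQ.
split=> [|b u v|u v].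
- by apply/mem_set; rewrite /= Delta1; exact: S1.
- move=> /set_mem hu /set_mem hv; apply/mem_set.
  exact: (eq_ind_r S (SD b hu hv) (linearP (@Delta K) b u v)).
move=> /set_mem hu /set_mem hv; apply/mem_set.
exact: (eq_ind_r S (SM hu hv) (@DeltaM K u v)).
Qed.

(** Stability of [A] under the antipode amounts to every t_n satisfying [P], which is closed under
    the algebra operations. *)
Let P (x : H) : Prop := A x /\ A (antipode x).

Let P1 : P 1.
Proof. by split; rewrite ?antipode1; exact: A1. Qed.

Let P0 : P 0.
Proof. by split; rewrite ?(linear0 (@antipode K)); exact: A0. Qed.

Let PD (b : K) (x y : H) : P x -> P y -> P (b *: x + y).
Proof.
move=> [Ax ASx] [Ay ASy]; split; first exact: AD.
have -> : antipode (b *: x + y) = b *: antipode x + antipode y by exact: linearP.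
exact: AD.
Qed.

Let PM (x y : H) : P x -> P y -> P (x * y).
Proof.
move=> [Ax ASx] [Ay ASy]; split; first exact: AM.
by rewrite antipodeM; exact: AM.
Qed.

(** The identity [antipode_l] at q_(0,m+1) expresses its antipode through those of q_(l,m+1-l) with
    l > 0, of smaller degree. *)
Let P_rec m : (forall j, (0 < j <= m)%N -> P (c j)) -> P (Q 0 m.+1).
Proof.
move=> Pc; split; first exact: AQ.
have := antipode_l (Q 0 m.+1).
rewrite (Q_mone K0 extend_coef0 Q_Bplus) scale0r.
rewrite (Delta_Q K0 extend_coef_prelie extend_coef0 Q_Bplus).
(* The term l = 0 is the antipode of q_(0,m+1) itself. *)
rewrite (linear_sum (conv _ _)) big_ord_recl.
rewrite [X in X + _](conv_tens _ _ (@antipode_linear K) (@id_linear K)).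
set s := \sum_(_ < _) _.
have -> : Q 0 (val (@ord0 m.+1)) = 1 by exact: q0.
rewrite mulr1 subn0 add0n.
move=> E; have -> : antipode (Q 0 m.+1) = (-1) *: s + 0.
  by rewrite addr0 scaleN1r; apply/eqP; rewrite -addr_eq0; apply/eqP; exact: E.
apply: AD; last exact: A0.
rewrite /s; elim/big_ind: _ => [|x y Ax Ay|j _]; first exact: A0.
  by rewrite -[x]scale1r; exact: AD.
apply: (eq_ind_r (fun x : H => A x) _ (conv_tens _ _ (@antipode_linear K) (@id_linear K))).
apply: AM; last exact: AQ.
suff [] : P (Q (0 + lift ord0 j) (m.+1 - lift ord0 j)) by [].
apply: subalgebra_Q => // h /andP[h0 hm]; apply: Pc; rewrite h0 (leq_trans hm) //.
by rewrite lift0 subSS leq_subr.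
Qed.

Let antipode_A : @antipode K @` A `<=` A.
Proof.
move=> _ [x Ax <-]; move: x Ax.
apply: (gen_subalgebra_sub (A := [set x | A (antipode x)])); last first.
  move=> _ [n _ <-]; suff [] : P (t n) by [].
  apply: subalgebra_Q => // j /andP[j0 _].
  by apply: (@subalgebra_c P P1 P0 PD PM j) => [m _|]; [exact: P_rec | rewrite j0 leqnSn].
split=> [|b u v|u v].
- by apply/mem_set; rewrite /= antipode1; exact: A1.
- move=> /set_mem hu /set_mem hv; apply/mem_set.
  exact: (eq_ind_r (fun x : H => A x) (AD b hu hv) (linearP (@antipode K) b u v)).
move=> /set_mem hu /set_mem hv; apply/mem_set.
exact: (eq_ind_r (fun x : H => A x) (AM hu hv) (@antipodeM K u v)).
Qed.

Let t_Seq : @Seq K t.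
Proof.
split.
- move=> n; split; first exact: t_neq0.
  exact/lin_span_trees/t_tree_comb.
- rewrite /t Q_Bplus q0 mon1 Bplus_mon bulletE; exact: esym (mkmalgU_mon _ _).
split; [exact: gen_subalgebra_closed | exact: comul_A |].
exists (@antipode K : {linear HCK K -> HCK K}); first exact: antipode_is_antipode.
exact: antipode_A.
Qed.

(** D_T t_(i+j) is known from the construction, with [l], and from [D_Seq], with the structure
    coefficients; T with nonzero coefficient in t_j allows the comparison. *)
Lemma structure_coef_surj : exists2 t : posint -> HCK K, Seq t & structure_coef t = l.
Proof.
exists t; first exact: t_Seq.
apply/funext => i; apply/funext => j.
have [T Tj aT] := tree_comb_neq0 (@t_tree_comb j) (t_neq0 j).
have E := etrans (esym (D_t_add i Tj)) (D_Seq t_Seq i Tj).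
exact: esym (mulfI aT (scaler_injr (t_neq0 i) E)).
Qed.

End Surjectivity.

Theorem theorem12 (K : fieldType) (K_char0 : ([pchar K] =i pred0)%R) :
  set_bij (@Seq K) (@Lambda K) (@structure_coef K).
Proof.
split.
- by move=> t tS; exact: structure_coef_Lambda.
- move=> t t' /set_mem tS /set_mem tS'; exact: structure_coef_inj.
by move=> l lL; have [t tS tl] := structure_coef_surj K_char0 lL; exists t.
Qed.
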